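(* The $7$-dimensional complex sphere $SO(8,\mathbb{C})/SO(7,\mathbb{C})$ admits a compact Clifford-Klein form.
   Context: For $G$ a Lie group and $H$ a closed subgroup, if $\Gamma$ is a discrete subgroup of $G$ acting properly discontinuously and freely on $G/H$, the manifold $\Gamma\backslash G/H$ is called a Clifford-Klein form of $G/H$. $G/H$ admits a compact Clifford-Klein form if such a $\Gamma$ exists with $\Gamma\backslash G/H$ compact. The $n$-dimensional complex sphere is $S^n_{\mathbb{C}}=\{(z_1,\dots,z_{n+1})\in\mathbb{C}^{n+1}: z_1^2+\dots+z_{n+1}^2=1\}$, which is biholomorphic to the homogeneous space $SO(n+1,\mathbb{C})/SO(n,\mathbb{C})$; Clifford-Klein forms are taken with respect to $G=SO(n+1,\mathbb{C})$, $H=SO(n,\mathbb{C})$. *)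

(* Defs.v *)
From HB Require Import structures.
From mathcomp Require Import all_boot all_order all_algebra.
From mathcomp Require Import all_classical all_reals all_analysis.
From mathcomp Require Import complex.

Set Implicit Arguments.
Unset Strict Implicit.
Unset Printing Implicit Defensive.

Import Order.TTheory GRing.Theory Num.Theory.
Import numFieldNormedType.Exports.

Local Open Scope classical_set_scope.
Local Open Scope quotient_scope.
Local Open Scope group_scope.

HB.mixin Record isTopologicalGroup G of Group G & Topological G := {
  mulg_continuous : continuous (fun p : G * G => p.1 * p.2);
  invg_continuous : continuous (fun x : G => x^-1)
}.

#[short(type="topologicalGroupType")]
HB.structure Definition TopologicalGroup :=
  {G of Group G & Topological G & isTopologicalGroup G}.

Section HomogeneousSpace.
Variables (G : topologicalGroupType) (H : groupClosed G).
Implicit Types g x y : G.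

Definition coset_rel : rel G := fun x y => x^-1 * y \in H.

Lemma coset_rel_refl : reflexive coset_rel.
Proof. by move=> x; rewrite /coset_rel mulVg gpred1. Qed.

Lemma coset_rel_sym : symmetric coset_rel.
Proof. by move=> x y; rewrite /coset_rel -[RHS]gpredV invgM invgK. Qed.

Lemma coset_rel_trans : transitive coset_rel.
Proof.
move=> y x z xy yz; rewrite /coset_rel -(mulVKg y z) mulgA.
exact: gpredM.
Qed.

Canonical coset_equiv :=
  EquivRel coset_rel coset_rel_refl coset_rel_sym coset_rel_trans.

(* G/H: the set of left cosets xH, with the quotient topology *)
Definition homogeneous_space := quotient_topology {eq_quot coset_equiv}.

HB.instance Definition _ := Topological.on homogeneous_space.
HB.instance Definition _ := Quotient.on homogeneous_space.

Implicit Types p q r : homogeneous_space.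

Definition translate g p : homogeneous_space :=
  \pi_homogeneous_space (g * repr p).

Lemma homogeneous_space_piP x y :
  (\pi_homogeneous_space x = \pi_homogeneous_space y) <-> x^-1 * y \in H.
Proof.
by split=> [/(@eqquotP _ coset_equiv {eq_quot coset_equiv})//|xy];
  apply/(@eqquotP _ coset_equiv {eq_quot coset_equiv}).
Qed.

Lemma translate_pi g x :
  translate g (\pi_homogeneous_space x) = \pi_homogeneous_space (g * x).
Proof.
rewrite /translate; apply/homogeneous_space_piP.
rewrite invgM -mulgA mulKg; apply/homogeneous_space_piP.
by rewrite reprK.
Qed.

Lemma translate1 : translate 1 =1 id.
Proof. by move=> p; rewrite /translate mul1g reprK. Qed.

Lemma translateM g g' p : translate (g * g') p = translate g (translate g' p).
Proof.
have -> : p = \pi_homogeneous_space (repr p) by rewrite reprK.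
by rewrite !translate_pi mulgA.
Qed.

Variable Gamma : groupClosed G.

Definition acts_properly_discontinuously : Prop :=
  forall K : set homogeneous_space, compact K ->
    finite_set [set g | g \in Gamma /\ (translate g @` K) `&` K !=set0].

Definition acts_freely : Prop :=
  forall g p, g \in Gamma -> translate g p = p -> g = 1.

Definition orbit_rel : rel homogeneous_space :=
  fun p q => `[< exists2 g, g \in Gamma & translate g p = q >].

Lemma orbit_rel_refl : reflexive orbit_rel.
Proof. by move=> p; apply/asboolP; exists 1; rewrite ?gpred1 ?translate1. Qed.

Lemma orbit_rel_sym : symmetric orbit_rel.
Proof.
move=> p q; apply/asboolP/asboolP => -[g gG <-];
  by exists g^-1; rewrite ?gpredV// -translateM mulVg translate1.
Qed.

Lemma orbit_rel_trans : transitive orbit_rel.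
Proof.
move=> q p r /asboolP[g gG <-] /asboolP[g' gG' <-]; apply/asboolP.
by exists (g' * g); rewrite ?gpredM// translateM.
Qed.

Canonical orbit_equiv :=
  EquivRel orbit_rel orbit_rel_refl orbit_rel_sym orbit_rel_trans.

(* the double quotient Gamma\G/H, with the quotient topology *)
Definition Clifford_Klein_form := quotient_topology {eq_quot orbit_equiv}.

HB.instance Definition _ := Topological.on Clifford_Klein_form.
HB.instance Definition _ := Quotient.on Clifford_Klein_form.

End HomogeneousSpace.

Definition discrete_subgroup (G : topologicalGroupType) (Gamma : groupClosed G)
    : Prop :=
  forall g : G, g \in Gamma -> \forall x \near g, x \in Gamma -> x = g.

(* Stated for topological groups: the notion does not refer to the smooth
   structure of G, and Gamma\G/H inherits that of G/H since the action is free
   and properly discontinuous. *)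
Definition admits_compact_Clifford_Klein_form (G : topologicalGroupType)
    (H : groupClosed G) : Prop :=
  exists Gamma : groupClosed G,
    [/\ discrete_subgroup Gamma,
        acts_properly_discontinuously H Gamma,
        acts_freely H Gamma &
        compact [set: Clifford_Klein_form H Gamma]].

Local Open Scope ring_scope.

Section SpecialOrthogonal.
Variables (K : numFieldType) (n : nat).

Definition special_orthogonal : {pred 'M[K]_n} :=
  [pred A | (A^T *m A == 1%:M) && (\det A == 1)].

Definition SO := {A : 'M[K]_n | A \in special_orthogonal}.

HB.instance Definition _ := SubChoice.on SO.
HB.instance Definition _ :=
  Topological.copy SO (initial_topology (val : SO -> 'M[K]_n)).

Lemma SO_trmxl (A : SO) : (val A)^T *m val A = 1%:M.
Proof. by have /andP[/eqP] := valP A. Qed.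

Lemma SO_trmxr (A : SO) : val A *m (val A)^T = 1%:M.
Proof. exact/mulmx1C/SO_trmxl. Qed.

Lemma SO_det (A : SO) : \det (val A) = 1.
Proof. by have /andP[_ /eqP] := valP A. Qed.

Fact SO_one_subproof : 1%:M \in special_orthogonal.
Proof. by rewrite inE trmx1 mulmx1 det1 !eqxx. Qed.

Fact SO_mul_subproof (A B : SO) : val A *m val B \in special_orthogonal.
Proof.
rewrite inE trmx_mul -mulmxA (mulmxA _ (val A)) SO_trmxl mul1mx SO_trmxl.
by rewrite det_mulmx !SO_det mulr1 !eqxx.
Qed.

Fact SO_inv_subproof (A : SO) : (val A)^T \in special_orthogonal.
Proof. by rewrite inE trmxK SO_trmxr det_tr SO_det !eqxx. Qed.

Definition SO_one : SO := Sub 1%:M SO_one_subproof.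
Definition SO_mul (A B : SO) : SO := Sub (val A *m val B) (SO_mul_subproof A B).
Definition SO_inv (A : SO) : SO := Sub (val A)^T (SO_inv_subproof A).

Fact SO_mulA : associative SO_mul.
Proof. by move=> A B C; apply/val_inj/mulmxA. Qed.
Fact SO_mul1g : left_id SO_one SO_mul.
Proof. by move=> A; apply/val_inj/mul1mx. Qed.
Fact SO_mulg1 : right_id SO_one SO_mul.
Proof. by move=> A; apply/val_inj/mulmx1. Qed.
Fact SO_mulVg : left_inverse SO_one SO_inv SO_mul.
Proof. by move=> A; apply/val_inj/SO_trmxl. Qed.
Fact SO_mulgV : right_inverse SO_one SO_inv SO_mul.
Proof. by move=> A; apply/val_inj/SO_trmxr. Qed.

HB.instance Definition _ :=
  isGroup.Build SO SO_mulA SO_mul1g SO_mulg1 SO_mulVg SO_mulgV.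

Lemma val_SO_continuous : continuous (val : SO -> 'M[K]_n).
Proof. exact: initial_continuous. Qed.

Lemma SO_coord_continuous i j : continuous (fun A : SO => val A i j).
Proof.
move=> A.
apply: (@continuous_comp SO 'M[K]_n K (fun B => val B) (fun M => M i j)).
  exact: val_SO_continuous.
exact: coord_continuous.
Qed.

Lemma mx_continuous (T : topologicalType) (f : T -> 'M[K]_n) :
  (forall i j, continuous (fun x => f x i j)) -> continuous f.
Proof.
move=> cf x U [P xP PU]; apply: (filterS (fun y => PU (f y))).
apply: (@filter_forall T 'I_n (fun i y => forall j, P i j (f y i j))) => i.
apply: filter_forall => j; exact/cf/xP.
Qed.

Fact SO_mulg_continuous : continuous (fun p : SO * SO => (p.1 * p.2)%g).
Proof.
apply: continuous_comp_initial; apply: mx_continuous => i j [A B].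
rewrite (_ : (fun _ => _) =
    fun p : SO * SO => \sum_k (val p.1 i k * val p.2 k j)); last first.
  by apply/funext => p; rewrite /= mxE.
apply: (@cvg_big _ _ _ _ _ add_continuous) => k _.
apply: (@cvgM K).
  apply: (continuous_comp (f := fst) (g := fun A : SO => val A i k)).
    exact: cvg_fst.
  exact: SO_coord_continuous.
apply: (continuous_comp (f := snd) (g := fun A : SO => val A k j)).
  exact: cvg_snd.
exact: SO_coord_continuous.
Qed.

Fact SO_invg_continuous : continuous (fun A : SO => (A^-1)%g).
Proof.
apply: continuous_comp_initial; apply: mx_continuous => i j A.
rewrite (_ : (fun _ => _) = fun B : SO => val B j i); last first.
  by apply/funext => B; rewrite /= mxE.
exact: SO_coord_continuous.
Qed.

HB.instance Definition _ :=
  isTopologicalGroup.Build SO SO_mulg_continuous SO_invg_continuous.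

End SpecialOrthogonal.

Section StandardSubgroup.
Variables (K : numFieldType) (n : nat).

(* The copy of SO(n) in SO(n+1) that fixes the first basis vector. *)
Definition SO_standard : {pred SO K n.+1} :=
  fun g => `[< exists A : SO K n, val g = lift0_mx (val A) >].

Lemma SO_standardP (g : SO K n.+1) :
  reflect (exists A : SO K n, val g = lift0_mx (val A))
          (g \in SO_standard).
Proof. exact: asboolP. Qed.

Fact SO_standard1 : 1%g \in SO_standard.
Proof.
by apply/SO_standardP; exists 1%g; rewrite /= /lift0_mx -(@scalar_mx_block _ 1 n).
Qed.

Fact SO_standardM : mulg_closed SO_standard.
Proof.
move=> g h /SO_standardP[A gA] /SO_standardP[B hB]; apply/SO_standardP.
exists (A * B)%g; rewrite [LHS]/= gA hB (@mulmx_block _ 1 n 1 n 1 n).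
by rewrite !(mulmx0, mul0mx, mulmx1, addr0, add0r).
Qed.

Fact SO_standardV : invg_closed SO_standard.
Proof.
move=> g /SO_standardP[A gA]; apply/SO_standardP.
by exists A^-1%g; rewrite [LHS]/= gA (@tr_block_mx _ 1 n 1 n) !trmx0 trmx1.
Qed.

HB.instance Definition _ := isMulClosed.Build _ SO_standard SO_standardM.
HB.instance Definition _ := isMul1Closed.Build _ SO_standard SO_standard1.
HB.instance Definition _ := isInvClosed.Build _ SO_standard SO_standardV.

Lemma SO_standard_closed : closed [set g | g \in SO_standard].
Proof.
pose b (ij : 'I_n.+1 * 'I_n.+1) :=
  (ij.1 == 0%N :> nat) || (ij.2 == 0%N :> nat).
rewrite (_ : [set _ | _] = \bigcap_(ij in [set ij | b ij])
    (fun g : SO K n.+1 => val g ij.1 ij.2) @^-1` [set (ij.1 == ij.2)%:R]).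
  apply: closed_bigI => -[i j] _; apply: preimage_closed.
    by move=> g _; exact: SO_coord_continuous.
  exact/accessible_closed_set1/hausdorff_accessible/norm_hausdorff.
have col1 (i j : 'I_n.+1) : b (i, j) -> forall A : 'M[K]_n,
    lift0_mx A i j = (i == j)%:R.
  move=> bij A; case: (@split_ordP 1 n i) bij => k ->;
    case: (@split_ordP 1 n j) => l -> bij;
    rewrite ?(block_mxEul, block_mxEur, block_mxEdl, block_mxEdr) ?mxE.
  - by rewrite -!val_eqE.
  - by rewrite -val_eqE /= ord1.
  - by rewrite -val_eqE /= ord1.
  - by [].
apply/seteqP; split => g /=.
  by move=> /SO_standardP[A gA] [i j] /= bij; rewrite gA col1.
move=> gb; pose B := @drsubmx K 1 n 1 n (val g).
have gB : val g = lift0_mx B.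
  apply/matrixP => i j; have [/[dup] bij /gb /= ->|] := boolP (b (i, j)).
    by rewrite col1.
  case: (@split_ordP 1 n i) => k ->; case: (@split_ordP 1 n j) => l ->;
    rewrite /b /= ?ord1 ?orbT // => _.
  by rewrite [RHS](@block_mxEdr _ 1 n 1 n) !mxE.
have BSO : B \in @special_orthogonal K n.
  have := SO_trmxl g; have := SO_det g.
  rewrite gB (@det_ublock _ 1 n) det1 mul1r => B1.
  rewrite (@tr_block_mx _ 1 n 1 n) (@mulmx_block _ 1 n 1 n 1 n) !trmx0 trmx1.
  rewrite !(mulmx0, mul0mx, mulmx1) !(addr0, add0r) (@scalar_mx_block _ 1 n).
  by move=> /(@eq_block_mx _ 1 n 1 n)[_ _ _ BB]; rewrite inE BB B1 !eqxx.
by apply/SO_standardP; exists (Sub B BSO).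
Qed.

End StandardSubgroup.

Arguments special_orthogonal K n : clear implicits.
Arguments SO K n : clear implicits.
Arguments SO_standard K n : clear implicits.
Arguments admits_compact_Clifford_Klein_form G H : clear implicits.

(* Main.v *)
Require Import Defs.
From HB Require Import structures.
From mathcomp Require Import all_boot all_order all_algebra.
From mathcomp Require Import all_classical all_reals all_analysis.
From mathcomp Require Import complex.
From mathcomp Require Import ring lra zify.

(** $Spin(1,7)$ acts on the complex 7-sphere through a half-spin representation in
    $SO(8, \mathbb C)$, properly and transitively with compact isotropy groups, so that
    any torsion-free uniform lattice of $Spin(1,7)$ gives a compact Clifford-Klein form.
    Everything is made explicit with octonions.

    Minkowski space $\mathbb R^{1,7}$ consists of the Hermitian matrices $H(x)$ of left
    multiplication by $x_0 + i(x_1 e_1 + \dots + x_7 e_7)$; an element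
    $g \in SO(8, \mathbb C)$ covers the isometry $A$ if $g H(x) g^* = H(xA)$.  The spinor
    square $\psi(z)$, the covector $x \mapsto z^* \overline{H(x)} z$, maps the sphere
    $z \cdot z = 1$ to the hyperboloid (qf_psi), is equivariant (psi_lifts_dot), and is
    proper because $\psi(z)_0 = |z|^2$ (psi0).

    The group consists of the elements that cover isometries of the lattice
    $\mathbb Z[\sqrt 2]^8$ with the form $\sqrt 2 x_0^2 - x_1^2 - \dots - x_7^2$ which
    are congruent to $1$ modulo a large integer $m$.  The Galois conjugate of the form is
    negative definite.  Thus each point $z$ makes the lattice, of rank 16 over the
    integers, a positive definite lattice: the Lorentz form is made positive by means of
    $\psi(z)$, and minus the conjugate form is added.  Its determinant is bounded
    independently of $z$ (det_latform), and its minimum is at least one, since the form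
    has no isotropic lattice vector (latform_ge1).  By Hermite reduction
    (hermite_reduction) it has a basis of bounded length, uniformly in $z$
    (reduced_basis).  All properties of the action follow from this.

    - Proper discontinuity (arith_spin_finite): if $z$ and $gz$ are bounded, the integer
      matrix of $g$ is bounded, and $g$ is determined by it up to sign (lifts_uniq).
    - Freeness (arith_spin_free): if $gz = z$, then $g - 1$ maps a reduced basis to short
      vectors divisible by $m$, hence to zero; so $g$ is $1$ or $-1$, and $-1$ has no
      fixed point on the sphere.
    - Cocompactness (arith_spin_cocompact): reduced bases have only finitely many Gram
      matrices and residues modulo $m$, and two reduced bases that share them differ by
      an isometry in the congruence subgroup.  Such an isometry need not lift to
      $SO(8, \mathbb C)$, but up to sign it is a product of reflections
      (lorentz_spin_kind), and the quotient of two isometries of the same sign and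
      parity does lift (spin_kind_ratio).

    The topological part rests on the section $z \mapsto L_z$ of the orbit map
    $g \mapsto g e_0$, where $L_z$ is the left multiplication by the octonion $z$. *)

Set Implicit Arguments.
Unset Strict Implicit.
Unset Printing Implicit Defensive.

Import Order.TTheory GRing.Theory Num.Theory.
Import numFieldNormedType.Exports.

Local Open Scope classical_set_scope.
Local Open Scope quotient_scope.
Local Open Scope ring_scope.

Lemma big_ord8 (V : nmodType) (F : 'I_8 -> V) :
  \sum_i F i = F (inord 0) + F (inord 1) + F (inord 2) + F (inord 3)
             + F (inord 4) + F (inord 5) + F (inord 6) + F (inord 7).
Proof.
rewrite !big_ord_recl big_ord0 addr0 !addrA.
by do ![congr (_ + _)]; congr (F _); apply/val_inj; rewrite /= inordK.
Qed.

Lemma ord8P (P : 'I_8 -> Prop) :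
  P (inord 0) -> P (inord 1) -> P (inord 2) -> P (inord 3) ->
  P (inord 4) -> P (inord 5) -> P (inord 6) -> P (inord 7) -> forall i, P i.
Proof.
move=> P0 P1 P2 P3 P4 P5 P6 P7 i; rewrite -(inord_val i).
by case: i => -[|[|[|[|[|[|[|[|//]]]]]]]] ?.
Qed.

Lemma inord8E : ((((nat_of_ord (inord 0 : 'I_8) = 0%N) *
  (nat_of_ord (inord 1 : 'I_8) = 1%N) * (nat_of_ord (inord 2 : 'I_8) = 2%N) *
  (nat_of_ord (inord 3 : 'I_8) = 3%N) * (nat_of_ord (inord 4 : 'I_8) = 4%N) *
  (nat_of_ord (inord 5 : 'I_8) = 5%N) * (nat_of_ord (inord 6 : 'I_8) = 6%N) *
  (nat_of_ord (inord 7 : 'I_8) = 7%N))))%type.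
Proof. by rewrite !inordK. Qed.

(** * Octonions *)

Section Octonions.
Variable K : comNzRingType.
Implicit Types z w : 'cV[K]_8.

(** Coordinates of an octonion refer to a unit $e_0 = 1$ and imaginary units
    $e_1, \dots, e_7$; the table gives the matrix $L_z$ of $w \mapsto zw$ and the
    next one the matrix $R_z$ of $w \mapsto wz$. *)
Definition octl_entry z (i j : nat) : K :=
  let x0 := z (inord 0) 0 in let x1 := z (inord 1) 0 in
  let x2 := z (inord 2) 0 in let x3 := z (inord 3) 0 in
  let x4 := z (inord 4) 0 in let x5 := z (inord 5) 0 in
  let x6 := z (inord 6) 0 in let x7 := z (inord 7) 0 in
  nth 0 (nth [::] [::
    [:: x0; - x1; - x2; - x3; - x4; - x5; - x6; - x7];
    [:: x1;   x0; - x3;   x2; - x5;   x4;   x7; - x6];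
    [:: x2;   x3;   x0; - x1; - x6; - x7;   x4;   x5];
    [:: x3; - x2;   x1;   x0; - x7;   x6; - x5;   x4];
    [:: x4;   x5;   x6;   x7;   x0; - x1; - x2; - x3];
    [:: x5; - x4;   x7; - x6;   x1;   x0;   x3; - x2];
    [:: x6; - x7; - x4;   x5;   x2; - x3;   x0;   x1];
    [:: x7;   x6; - x5; - x4;   x3;   x2; - x1;   x0]] i) j.

Definition octl z : 'M[K]_8 := \matrix_(a, b) octl_entry z a b.

Definition octr_entry z (i j : nat) : K :=
  let x0 := z (inord 0) 0 in let x1 := z (inord 1) 0 in
  let x2 := z (inord 2) 0 in let x3 := z (inord 3) 0 in
  let x4 := z (inord 4) 0 in let x5 := z (inord 5) 0 in
  let x6 := z (inord 6) 0 in let x7 := z (inord 7) 0 in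
  nth 0 (nth [::] [::
    [:: x0; - x1; - x2; - x3; - x4; - x5; - x6; - x7];
    [:: x1;   x0;   x3; - x2;   x5; - x4; - x7;   x6];
    [:: x2; - x3;   x0;   x1;   x6;   x7; - x4; - x5];
    [:: x3;   x2; - x1;   x0;   x7; - x6;   x5; - x4];
    [:: x4; - x5; - x6; - x7;   x0;   x1;   x2;   x3];
    [:: x5;   x4; - x7;   x6; - x1;   x0; - x3;   x2];
    [:: x6;   x7;   x4; - x5; - x2;   x3;   x0; - x1];
    [:: x7; - x6;   x5;   x4; - x3; - x2;   x1;   x0]] i) j.

Definition octr z : 'M[K]_8 := \matrix_(a, b) octr_entry z a b.

Definition sqnorm z : K := \sum_i z i 0 ^+ 2.

Lemma sqnormE z : sqnorm z = (z^T *m z) 0 0.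
Proof. by rewrite mxE; apply: eq_bigr => k _; rewrite mxE expr2. Qed.

Lemma sqnorm_orth (g : 'M[K]_8) z : g^T *m g = 1%:M -> sqnorm (g *m z) = sqnorm z.
Proof.
by move=> gg; rewrite !sqnormE trmx_mul mulmxA -(mulmxA _ g^T) gg mulmx1.
Qed.

Definition octconj z : 'cV[K]_8 :=
  \col_k (if k == 0 then z k 0 else - z k 0).

(** The norm of the octonions is multiplicative. *)
Lemma octl_mulmx_tr z : octl z *m (octl z)^T = (sqnorm z)%:M.
Proof.
apply/matrixP => a b; rewrite !mxE /sqnorm !big_ord8 -val_eqE /= !mxE !inord8E.
elim/ord8P: a; elim/ord8P: b; rewrite !inord8E /octl_entry /octr_entry /=; ring.
Qed.

Lemma octr_mulmx_tr z : octr z *m (octr z)^T = (sqnorm z)%:M.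
Proof.
apply/matrixP => a b; rewrite !mxE /sqnorm !big_ord8 -val_eqE /= !mxE !inord8E.
elim/ord8P: a; elim/ord8P: b; rewrite !inord8E /octl_entry /octr_entry /=; ring.
Qed.

Lemma octl_octr z w : octl z *m w = octr w *m z.
Proof.
apply/matrixP => a b; rewrite ord1 !mxE !big_ord8 !mxE !inord8E.
by elim/ord8P: a; rewrite ?inord8E /octl_entry /octr_entry /=; ring.
Qed.

Lemma octl_tr z : (octl z)^T = octl (octconj z).
Proof.
apply/matrixP => a b; rewrite !mxE.
by elim/ord8P: a; elim/ord8P: b;
  rewrite ?inord8E /octl_entry /= !mxE -!val_eqE /= !inord8E ?opprK.
Qed.

Lemma col0_octl z : col 0 (octl z) = z.
Proof.
apply/matrixP => a b; rewrite ord1 !mxE /=.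
by elim/ord8P: a; rewrite ?inord8E.
Qed.

Lemma col0_octr z : col 0 (octr z) = z.
Proof.
apply/matrixP => a b; rewrite ord1 !mxE /=.
by elim/ord8P: a; rewrite ?inord8E.
Qed.

Lemma octl1 : octl (delta_mx 0 0) = 1%:M.
Proof.
apply/matrixP => a b; rewrite !mxE -val_eqE /=.
by elim/ord8P: a; elim/ord8P: b;
  rewrite ?inord8E /octl_entry /= !mxE -!val_eqE /= !inord8E ?oppr0.
Qed.

Lemma octlD z w : octl (z + w) = octl z + octl w.
Proof.
apply/matrixP => a b; rewrite !mxE.
by elim/ord8P: a; elim/ord8P: b; rewrite ?inord8E /octl_entry /= !mxE ?opprD.
Qed.

Lemma octlZ (c : K) z : octl (c *: z) = c *: octl z.
Proof.
apply/matrixP => a b; rewrite !mxE.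
by elim/ord8P: a; elim/ord8P: b; rewrite ?inord8E /octl_entry /= !mxE ?mulrN.
Qed.

(** The nucleus of the octonions consists of the scalars: every imaginary unit
    fails to associate with some pair of units, and the corresponding matrix entry
    isolates one coordinate of $u$. *)
Lemma octr_comm_octl u :
  (forall j, octr u *m octl (delta_mx j 0) = octl (delta_mx j 0) *m octr u) ->
  GRing.rreg (2 : K) -> forall k, k != 0 -> u k 0 = 0.
Proof.
move=> comm reg2.
have entry (a b c : nat) : (octr u *m octl (delta_mx (inord a) 0))
      (inord c) (inord b) - (octl (delta_mx (inord a) 0) *m octr u)
      (inord c) (inord b) = 0.
  by rewrite comm subrr.
have half (x y : K) : y = 0 -> (x *+ 2 = y \/ - x *+ 2 = y) -> x = 0.
  move=> -> [xx|xx]; apply: reg2; rewrite mul0r mulr_natr //.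
  by rewrite -[x *+ 2]opprK -mulNrn xx oppr0.
(* for each unit e_k, two units e_a, e_b that do not associate with it, and
   the index c of the product of the three *)
elim/ord8P; rewrite -?val_eqE /= ?inord8E //= => _;
  [apply: half (entry 2 4 7)%N _ | apply: half (entry 1 4 7)%N _
  | apply: half (entry 1 4 6)%N _ | apply: half (entry 1 2 7)%N _
  | apply: half (entry 1 2 6)%N _ | apply: half (entry 1 2 5)%N _
  | apply: half (entry 1 2 4)%N _];
  rewrite !mxE !big_ord8 !mxE !inord8E /octl_entry /octr_entry /= !mxE
    -!val_eqE /= !inord8E /=; first [left; ring | right; ring].
Qed.

End Octonions.

Lemma map_octl (K L : comNzRingType) (f : {rmorphism K -> L}) (z : 'cV[K]_8) :
  map_mx f (octl z) = octl (map_mx f z).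
Proof.
apply/matrixP => a b; rewrite !mxE.
by elim/ord8P: a; elim/ord8P: b; rewrite ?inord8E /octl_entry /= !mxE ?rmorphN.
Qed.

(** From $L_z L_z^T = (z \cdot z) I$ the square of $\det L_z$ is $(z \cdot z)^8$.  The
    sign of the root is found by making the real part of $z$ an indeterminate:
    then $\det L_z$ is a characteristic polynomial, hence monic. *)
Lemma det_octl (K : idomainType) (z : 'cV[K]_8) : (2 : K) != 0 ->
  \det (octl z) = sqnorm z ^+ 4.
Proof.
move=> two0.
pose zX : 'cV[{poly K}]_8 := \col_k (if k == 0 then 'X else (z k 0)%:P).
pose p := \det (octl zX); pose q := sqnorm zX ^+ 4.
have qE : sqnorm zX = 'X^2 + (\sum_(k : 'I_8 | k != 0) z k 0 ^+ 2)%:P.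
  rewrite /sqnorm (bigD1 0)//= mxE eqxx rmorph_sum /=; congr (_ + _).
  by apply: eq_bigr => k /negbTE k0; rewrite mxE k0 rmorphXn.
have qmon : q \is monic.
  apply: monic_exp; rewrite qE monicE lead_coefDl ?lead_coefXn//.
  by rewrite size_polyXn (leq_ltn_trans (size_polyC_leq1 _)).
have pmon : p \is monic.
  rewrite (_ : p = char_poly (- octl (\col_k (if k == 0 then 0 else z k 0)))).
    exact: char_poly_monic.
  congr (\det _); rewrite /char_poly_mx map_mxN opprK.
  rewrite map_octl; apply/matrixP => a b; rewrite !mxE -val_eqE.
  by elim/ord8P: a; elim/ord8P: b; rewrite ?inord8E /octl_entry /= !mxE
    -!val_eqE /= ?inord8E ?mulr1n ?mulr0n ?add0r
    ?rmorph0 ?addr0.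
have pq : (p - q) * (p + q) = 0.
  rewrite -subr_sqr; apply/eqP; rewrite subr_eq0; apply/eqP.
  rewrite expr2 -{2}[p]det_tr -det_mulmx octl_mulmx_tr det_scalar.
  by rewrite -exprM.
have epq : p = q.
  move/eqP: pq; rewrite mulf_eq0 subr_eq0 => /orP[/eqP//|].
  rewrite addr_eq0 => /eqP e; move: pmon qmon; rewrite !monicE e lead_coefN.
  move=> /eqP e1 /eqP e2; case/eqP: two0.
  by rewrite mulr2n -{1}e1 e2 addNr.
have zE : map_mx (horner_eval (z 0 0)) zX = z.
  apply/matrixP => a b; rewrite ord1 !mxE /horner_eval.
  by case: eqP => [->|_]; rewrite ?hornerX ?hornerC.
have := congr1 (horner_eval (z 0 0)) epq.
rewrite /p /q -det_map_mx map_octl zE rmorphXn /= => ->; congr (_ ^+ 4).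
rewrite /sqnorm rmorph_sum /=; apply: eq_bigr => k _.
by rewrite rmorphXn -[in RHS]zE !mxE.
Qed.

(** * Hermite reduction of quadratic forms *)

Definition qf (R : comNzRingType) n (S : 'M[R]_n) (v : 'rV[R]_n) : R :=
  (v *m S *m v^T) 0 0.

Definition intmx (R : nzRingType) m n (A : 'M[int]_(m, n)) : 'M[R]_(m, n) :=
  map_mx intr A.
Arguments intmx R {m n} A.

Lemma qfM (R : comNzRingType) m n (S : 'M[R]_n) (A : 'M[R]_(m, n)) (v : 'rV[R]_m) :
  qf (A *m S *m A^T) v = qf S (v *m A).
Proof. by rewrite /qf trmx_mul !mulmxA. Qed.

Lemma qfZ (R : comNzRingType) n (S : 'M[R]_n) a v : qf S (a *: v) = a ^+ 2 * qf S v.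
Proof.
by rewrite /qf linearZ /= -!scalemxAl -scalemxAr !mxE mulrA -expr2.
Qed.

Lemma qfD (R : comNzRingType) n (S : 'M[R]_n) v w : qf S (v + w) =
  qf S v + qf S w + ((v *m S *m w^T) 0 0 + (w *m S *m v^T) 0 0).
Proof.
have aE (A B : 'M[R]_1) : (A + B) 0 0 = A 0 0 + B 0 0 by rewrite mxE.
by rewrite /qf linearD /= mulmxDl mulmxDr !mulmxDl !aE; ring.
Qed.

Lemma bilC (R : comNzRingType) n (S : 'M[R]_n) (v w : 'rV[R]_n) : S^T = S ->
  (v *m S *m w^T) 0 0 = (w *m S *m v^T) 0 0.
Proof.
move=> Ssym; have tr (M : 'M[R]_1) : M 0 0 = M^T 0 0 by rewrite mxE.
by rewrite tr !trmx_mul trmxK Ssym mulmxA.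
Qed.

Lemma qfD_sym (R : comNzRingType) n (S : 'M[R]_n) (v w : 'rV[R]_n) : S^T = S ->
  qf S (v + w) = qf S v + qf S w + 2 * (v *m S *m w^T) 0 0.
Proof. by move=> Ssym; rewrite qfD (bilC w v Ssym); ring. Qed.

Lemma qfB_sym (R : comNzRingType) n (S : 'M[R]_n) (v w : 'rV[R]_n) : S^T = S ->
  qf S (v - w) = qf S v + qf S w - 2 * (v *m S *m w^T) 0 0.
Proof.
move=> Ssym; rewrite qfD_sym// -scaleN1r qfZ sqrrN expr1n mul1r.
by rewrite linearZ /= -scalemxAr mxE; ring.
Qed.

Section Reduction.
Variable R : realType.

Lemma exists_near_int (x : R) : exists t : int, (t%:~R + x) ^+ 2 <= 4^-1.
Proof.
exists (- Num.floor (x + 2^-1)); rewrite rmorphN /=.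
have /andP[h1 h2] := floor_itv (x + 2^-1).
rewrite intrD in h2.
set k := _%:~R in h1 h2 *.
have : (- k + x - 2^-1) * (- k + x + 2^-1) <= 0.
  by rewrite mulr_le0_ge0//; lra.
by move=> h; nra.
Qed.

(** Completing the square; the Schur complement is the form induced on the
    orthogonal complement of the first basis vector. *)
Lemma qf_schur n (s : R) (r : 'rV[R]_n) (S : 'M[R]_n) (t : R) (w : 'rV[R]_n) :
  s != 0 ->
  qf (block_mx s%:M r r^T S : 'M[R]_(1 + n)) (row_mx t%:M w) =
  s * (t + (w *m r^T) 0 0 / s) ^+ 2 + qf (S - s^-1 *: (r^T *m r)) w.
Proof.
move=> s0; rewrite /qf mul_row_block tr_row_mx mul_row_col mulmxBr mulmxBl.
rewrite -scalemxAr -scalemxAl (mulmxA w) -(mulmxA (w *m r^T)).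
rewrite (mx11_scalar (w *m r^T)) -[r *m w^T]trmxK trmx_mul trmxK.
rewrite (mx11_scalar (w *m r^T)) tr_scalar_mx !tr_scalar_mx.
rewrite !mulmxDl -!scalar_mxM !mul_scalar_mx -!scalemxAl.
rewrite -[r *m w^T]trmxK trmx_mul trmxK (mx11_scalar (w *m r^T)) tr_scalar_mx.
rewrite !mxE /= !mulr1n; set a := (\sum_j _); set b := \sum_j _.
by field.
Qed.

Lemma qf_eq_int_scale n (S : 'M[R]_n) (k : int) (v : 'rV[int]_n) : k != 0 ->
  0 <= qf S (intmx R v) -> qf S (intmx R v) <= qf S (intmx R (k *: v)).
Proof.
move=> k0 v0; rewrite /intmx map_mxZ /= qfZ ler_peMl//.
by rewrite sqr_intr_ge1 ?intr_eq0 ?intr_int.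
Qed.

(** By the Smith form, any integer row is a multiple of the first row of a unimodular
    matrix; replacing an almost minimal row by that row only decreases the form. *)
Lemma near_minimal_unimodular n (S : 'M[R]_n.+1) (c : R) : 0 < c ->
    (forall v : 'rV[int]_n.+1, v != 0 -> c <= qf S (intmx R v)) ->
  exists2 U : 'M[int]_n.+1, U \in unitmx &
    forall v : 'rV[int]_n.+1, v != 0 ->
      qf S (intmx R (row 0 U)) <= 2 * qf S (intmx R v).
Proof.
move=> c0 Sc.
pose E := [set qf S (intmx R v) | v in [set v : 'rV[int]_n.+1 | v != 0]]%classic.
have E0 : has_inf E.
  split; last by exists c => _ [v /= v0 <-]; exact: Sc.
  exists (qf S (intmx R (delta_mx 0 0))), (delta_mx 0 0) => //=.
  by apply/eqP => /matrixP/(_ 0 0)/eqP; rewrite !mxE.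
have cE : c <= inf E by apply: lb_le_inf; [case: E0 | move=> _ [v /= v0 <-]; exact: Sc].
have infE0 : 0 < inf E by exact: lt_le_trans cE.
have [_ [v /= v0 <-] vinf] := inf_adherent infE0 E0.
have [L Lu [U Uu [d _ vLU]]] := int_Smith_normal_form v.
have vE : v = (L 0 0 * d`_0) *: row 0 U.
  rewrite vLU (mx11_scalar L) mul_scalar_mx -scalemxAl -scalerA.
  congr (_ *: _); first by rewrite !mxE.
  rewrite mulmx_sum_row big_ord_recl /= big1 ?addr0 => [|i _].
    by rewrite mxE.
  by rewrite mxE /= mulr0n scale0r.
exists U => // w w0.
have k0 : L 0 0 * d`_0 != 0 by apply: contraNneq v0 => k0; rewrite vE k0 scale0r.
have r0 : row 0 U != 0 by apply: contraNneq v0 => r0; rewrite vE r0 scaler0.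
apply: (@le_trans _ _ (qf S (intmx R v))).
  by rewrite vE; apply: qf_eq_int_scale => //; apply/ltW/lt_le_trans/Sc.
have : inf E <= qf S (intmx R w) by apply: ge_inf; [case: E0 | exists w].
by move: vinf; lra.
Qed.

(** Take a first basis vector whose value $s$ is at most twice the minimum of the form,
    and a reduced basis of its Schur complement, lifted with first coordinates chosen
    so that the lift adds at most $s/4$ to each value.  A lifted vector has value at
    least $s/2$, so that $s/4$ is at most half of it: lifting at most doubles the
    values.  For the same reason the Schur complement inherits a positive lower bound
    on nonzero integer vectors, which is all the induction needs. *)
Lemma hermite_reduction n : exists2 K : R, 0 < K &
  forall (S : 'M[R]_n) (c : R), S^T = S -> 0 < c ->
    (forall v : 'rV[int]_n, v != 0 -> c <= qf S (intmx R v)) ->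
  exists2 U : 'M[int]_n, U \in unitmx &
    \prod_i qf S (intmx R (row i U)) <= K * \det S.
Proof.
elim: n => [|n [K K0 IH]].
  exists 1 => // S c _ _ _; exists 1%:M; rewrite ?unitmx1//.
  by rewrite big_ord0 det_mx00 mulr1.
exists (2 ^+ n * K); first by rewrite mulr_gt0// exprn_gt0.
move=> S c Ssym c0 Sc.
have [V Vu Vmin] := near_minimal_unimodular c0 Sc.
pose T : 'M[R]_(1 + n) := intmx R V *m S *m (intmx R V)^T.
have intV (v : 'rV[int]_n.+1) : intmx R v *m intmx R V = intmx R (v *m V).
  by rewrite /intmx map_mxM.
have unitV (v : 'rV[int]_n.+1) : v != 0 -> v *m V != 0.
  move=> v0; apply: contra_neq v0 => vV.
  by rewrite -[v]mulmx1 -(mulmxV Vu) mulmxA vV mul0mx.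
have Tsym : T^T = T by rewrite /T !trmx_mul trmxK Ssym mulmxA.
pose s := (ulsubmx T : 'M[R]_1) 0 0; pose r : 'rV[R]_n := ursubmx T.
pose S' : 'M[R]_n := drsubmx T.
have TE : T = block_mx s%:M r r^T S'.
  rewrite -[LHS]submxK; congr block_mx; first by rewrite [LHS]mx11_scalar.
  by rewrite /r -{1}Tsym -trmx_ursub.
pose vec (t : int) (w : 'rV[int]_n) : 'rV[int]_(1 + n) := row_mx t%:M w.
have intvec t w : intmx R (vec t w) = row_mx t%:~R%:M (intmx R w).
  by rewrite /intmx map_row_mx map_scalar_mx.
have vec_neq0 t w : (t != 0) || (w != 0) -> vec t w != 0.
  apply: contraTneq => /(congr1 (fun v : 'rV[int]_(1 + n) => (lsubmx v, rsubmx v))).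
  rewrite row_mxKl row_mxKr linear0 linear0 => -[/matrixP/(_ 0 0) + ->].
  by rewrite !mxE /= mulr1n => ->; rewrite !eqxx.
have qT (v : 'rV[int]_n.+1) : qf T (intmx R v) = qf S (intmx R (v *m V)).
  by rewrite qfM intV.
have row0V : row 0 V = vec 1 0 *m V.
  rewrite rowE; congr (_ *m _); apply/rowP => j; rewrite /vec !mxE.
  by case: (@split_ordP 1 n j) => k ->; rewrite !mxE ?ord1.
have sT : s = qf T (intmx R (vec 1 0)).
  have -> : intmx R (vec 1 0) = row_mx 1%:M 0 by rewrite intvec /intmx map_mx0.
  rewrite /qf TE mul_row_block tr_row_mx mul_row_col trmx0 mulmx0 addr0.
  by rewrite !mul0mx !addr0 trmx1 mulmx1 mul1mx mxE.
have s_min (v : 'rV[int]_n.+1) : v != 0 -> s <= 2 * qf T (intmx R v).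
  by move=> v0; rewrite sT !qT -row0V; apply/Vmin/unitV.
have s_gt0 : 0 < s by apply: (lt_le_trans c0); rewrite sT qT; apply/Sc/unitV/vec_neq0.
have s0 : s != 0 by rewrite gt_eqF.
pose S2 := S' - s^-1 *: (r^T *m r).
have qS2 t w : qf T (intmx R (vec t w)) =
    s * (t%:~R + (intmx R w *m r^T) 0 0 / s) ^+ 2 + qf S2 (intmx R w).
  by rewrite intvec TE qf_schur.
have near w : {t : int | qf T (intmx R (vec t w)) <= s / 4 + qf S2 (intmx R w)}.
  apply/cid; have [t tw] := exists_near_int ((intmx R w *m r^T) 0 0 / s).
  by exists t; rewrite qS2 lerD2r ler_pM2l.
have S2sym : S2^T = S2.
  rewrite linearB linearZ /= trmx_mul trmxK; congr (_ - _).
  by rewrite /S' trmx_drsub Tsym.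
have s4_gt0 : 0 < s / 4 by rewrite divr_gt0.
have S2_min w : w != 0 -> s / 4 <= qf S2 (intmx R w).
  move=> w0; have [t tw] := near w.
  have := @s_min (vec t w); rewrite vec_neq0 ?w0 ?orbT// => /(_ isT).
  by move: tw; lra.
have [U Uu Uprod] := IH _ _ S2sym s4_gt0 S2_min.
pose tau i := sval (near (row i U)).
pose W : 'M[int]_(1 + n) := block_mx 1%:M 0 (\col_i tau i) U.
have Wu : W \in unitmx by rewrite unitmxE det_lblock det1 mul1r -unitmxE.
have row0W : row 0 W = vec 1 0.
  rewrite (_ : 0 = lshift n (0 : 'I_1)); last exact: val_inj.
  rewrite [LHS](@rowKu _ 1 n _ 0) row_row_mx /vec; congr row_mx.
    by apply/rowP => j; rewrite !mxE ord1.
  by apply/rowP => j; rewrite !mxE.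
have rowSW i : row (rshift 1 i) W = vec (tau i) (row i U).
  rewrite [LHS](@rowKd _ 1 n _ i) row_row_mx /vec; congr row_mx.
  by apply/rowP => j; rewrite !mxE ord1 mulr1n.
exists (W *m V); first by rewrite unitmx_mul Wu.
have Uneq0 i : row i U != 0.
  apply/eqP => Ui0; have : (delta_mx 0 i : 'rV[int]_n) = 0.
    by rewrite -(mulmxK Uu (delta_mx 0 i)) -rowE Ui0 mul0mx.
  by move/rowP/(_ i)/eqP; rewrite !mxE !eqxx.
have detT : \det T = s * \det S2.
  pose E : 'M[R]_(1 + n) := block_mx 1%:M 0 (s^-1 *: r^T) 1%:M.
  have -> : T = E *m block_mx s%:M r 0 S2.
    rewrite TE mulmx_block !mul1mx !mul0mx !addr0 mul_mx_scalar.
    by rewrite scalerA mulfV// scale1r /S2 -scalemxAl addrC subrK.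
  by rewrite det_mulmx det_lblock det_ublock !det1 !mul1r det_scalar1.
have detTS : \det T = \det S.
  have : (\det (intmx R V)) ^+ 2 = 1.
    rewrite /intmx det_map_mx; move: Vu; rewrite unitmxE => /unitrP[x [_ xV]].
    move: (\det V) xV => d xV.
    have : `|d|%N = 1%N.
      by have := congr1 absz xV; rewrite abszM => /eqP; rewrite muln_eq1 => /andP[/eqP].
    by case: (intP d) => // k; rewrite ?abszN /= => -[->]; rewrite ?rmorphN expr2 ?mulrNN mulr1.
  by rewrite /T !det_mulmx det_tr mulrAC -expr2 => ->; rewrite mul1r.
rewrite -detTS detT big_ord_recl (_ : ord0 = 0)// row_mul row0W -qT -sT.
rewrite (_ : _ * (s * _) = s * (2 ^+ n * (K * \det S2))); last by ring.
rewrite ler_pM2l//.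
apply: (@le_trans _ _ (\prod_i (2 * qf S2 (intmx R (row i U))))); last first.
  rewrite big_split /= prodr_const card_ord ler_pM2l ?exprn_gt0//.
apply: ler_prod => i _.
rewrite (_ : lift ord0 i = rshift 1 i); last exact: val_inj.
rewrite row_mul rowSW -qT; have tau_i := svalP (near (row i U)).
have := @s_min (vec (tau i) (row i U)).
rewrite vec_neq0 ?Uneq0 ?orbT// => /(_ isT).
by move: tau_i s_gt0; rewrite -/(tau i); lra.
Qed.

End Reduction.

(** * Spinors of signature (1,7) *)

Section Spin.
Variable R : realType.
Local Notation C := R[i].
Local Notation conjmx := (map_mx (@conjc R)).
Local Notation toC := (real_complex R).
Implicit Types (x y w : 'rV[R]_8) (z : 'cV[C]_8) (g h : 'M[C]_8) (A B : 'M[R]_8).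

Definition lorentz : 'M[R]_8 := diag_mx (\row_k (if k == 0 then 1 else -1)).

(** Minkowski space $\mathbb R^{1,7}$ is realised inside the complex octonions as the
    real multiples of $1$ plus $i$ times the real imaginary octonions.  There the
    matrix $H(x)$ of left multiplication is Hermitian, its transpose is its
    conjugate, and $H(x) H(x)^T$ is the Lorentz norm of $x$. *)
Definition lcoef (k : 'I_8) : C := if k == 0 then 1 else 'i%C.

Definition herm x : 'M[C]_8 := octl (\col_k (lcoef k * toC (x 0 k))).

(** For $g \in SO(8, \mathbb C)$ this says that $g$ belongs to the image of
    $Spin(1,7)$ in a half-spin representation and covers the isometry $A$.  As $A$
    acts on row vectors, products are reversed. *)
Definition lifts g A := forall x, g *m herm x *m (conjmx g)^T = herm (x *m A).

Lemma conjmxK m n (M : 'M[C]_(m, n)) : conjmx (conjmx M) = M.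
Proof. by apply/matrixP => i j; rewrite !mxE conjcK. Qed.

Lemma conjmxM m n p (M : 'M[C]_(m, n)) (N : 'M[C]_(n, p)) :
  conjmx (M *m N) = conjmx M *m conjmx N.
Proof. exact: map_mxM. Qed.

Lemma conjc_toC (a : R) : conjc (toC a) = toC a.
Proof. exact: conjc_real. Qed.

Lemma conjcM (a b : C) : conjc (a * b) = conjc a * conjc b.
Proof. exact: rmorphM. Qed.

Lemma lorentzE x y : (x *m lorentz *m y^T) 0 0 =
  \sum_k (if k == 0 then 1 else -1) * x 0 k * y 0 k.
Proof.
rewrite mxE; apply: eq_bigr => k _; rewrite mul_mx_diag !mxE.
by rewrite [x 0 k * _]mulrC.
Qed.

Lemma qf_lorentz x : qf lorentz x = \sum_k (if k == 0 then 1 else -1) * x 0 k ^+ 2.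
Proof. by rewrite /qf lorentzE; apply: eq_bigr => k _; rewrite -mulrA expr2. Qed.

Lemma lorentz_tr : lorentz^T = lorentz.
Proof. by rewrite /lorentz tr_diag_mx. Qed.

Lemma lorentz_sq : lorentz *m lorentz = 1%:M.
Proof.
rewrite /lorentz mulmx_diag -diag_const_mx; congr diag_mx.
by apply/rowP => k; rewrite !mxE; case: eqP; rewrite ?mulrNN mulr1.
Qed.

Lemma lorentz_sym x y : (x *m lorentz *m y^T) 0 0 = (y *m lorentz *m x^T) 0 0.
Proof. by rewrite !lorentzE; apply: eq_bigr => k _; rewrite mulrAC. Qed.

Lemma qf_lorentzD x y : qf lorentz (x + y) =
  qf lorentz x + qf lorentz y + 2 * (x *m lorentz *m y^T) 0 0.
Proof.
rewrite qfD (lorentz_sym y); ring.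
Qed.

Lemma herm_tr x : (herm x)^T = conjmx (herm x).
Proof.
rewrite octl_tr map_octl; congr octl; apply/matrixP => k j; rewrite !mxE /lcoef.
case: eqP => _; first by rewrite rmorphM rmorph1 /= oppr0.
by rewrite rmorphM -mulNr /= oppr0; simpc.
Qed.

Lemma herm_mul_tr x : herm x *m (herm x)^T = (toC (qf lorentz x))%:M.
Proof.
rewrite octl_mulmx_tr; congr (_%:M); rewrite /sqnorm qf_lorentz rmorph_sum /=.
apply: eq_bigr => k _; rewrite mxE exprMn rmorphM /= rmorphXn /=; congr (_ * _).
by rewrite /lcoef; case: eqP => _; rewrite ?expr1n ?sqr_i ?rmorphN ?rmorph1.
Qed.

Lemma hermD x y : herm (x + y) = herm x + herm y.
Proof.
rewrite -octlD; congr octl; apply/matrixP => k j.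
by rewrite !mxE rmorphD mulrDr.
Qed.

Lemma hermZ (a : R) x : herm (a *: x) = toC a *: herm x.
Proof.
rewrite -octlZ; congr octl; apply/matrixP => k j.
by rewrite !mxE rmorphM mulrCA.
Qed.

Lemma hermB x y : herm (x - y) = herm x - herm y.
Proof. by rewrite -scaleN1r hermD hermZ rmorphN rmorph1 scaleN1r. Qed.

Lemma lcoef_neq0 k : lcoef k != 0.
Proof.
rewrite /lcoef; case: (k == 0); first exact: oner_neq0.
by apply/eqP => -[/eqP]; rewrite oner_eq0.
Qed.

Lemma herm_inj x y : herm x = herm y -> x = y.
Proof.
move=> /(congr1 (col 0)); rewrite !col0_octl => /matrixP e.
apply/rowP => k; have /eqP := e k 0; rewrite !mxE.
by rewrite (inj_eq (mulfI (lcoef_neq0 k))) => /eqP /complexI.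
Qed.

Lemma herm_polar x y : herm x *m conjmx (herm y) + herm y *m conjmx (herm x) =
  (2 * toC ((x *m lorentz *m y^T) 0 0))%:M.
Proof.
have cancel (V : zmodType) (a b c u v : V) :
    a + v + (u + b) = a + b + c -> u + v = c.
  by rewrite (addrC u) addrACA => /addrI; rewrite addrC.
have := herm_mul_tr (x + y).
rewrite qf_lorentzD hermD linearD /= mulmxDl !mulmxDr !herm_mul_tr !herm_tr.
by rewrite 2!(rmorphD toC) 2!raddfD rmorphM rmorph_nat => /cancel <-; rewrite addrC.
Qed.

(** The covector $x \mapsto z^* \overline{H(x)} z$ attached to the spinor $z$.  It maps
    the complex sphere properly and equivariantly to the hyperboloid model of
    hyperbolic 7-space. *)
Definition psi z : 'cV[R]_8 :=
  \col_k complex.Re (conjc (lcoef k) * ((octr z)^T *m conjmx z) k 0).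

Lemma herm_form_real x z :
  ((conjmx z)^T *m conjmx (herm x) *m z) 0 0 =
  conjc (((conjmx z)^T *m conjmx (herm x) *m z) 0 0).
Proof.
have -> (M : 'M[C]_1) : conjc (M 0 0) = (conjmx M)^T 0 0 by rewrite !mxE.
rewrite !conjmxM -map_trmx !conjmxK !trmx_mul trmxK.
by rewrite herm_tr mulmxA.
Qed.

Lemma herm_form x z : ((conjmx z)^T *m conjmx (herm x) *m z) 0 0 =
  \sum_k toC (x 0 k) * (conjc (lcoef k) * ((octr z)^T *m conjmx z) k 0).
Proof.
have rE k : ((octr z)^T *m conjmx z) k 0 = ((conjmx z)^T *m octr z) 0 k.
  by rewrite -[octr z in RHS]trmxK -trmx_mul [RHS]mxE.
rewrite -mulmxA {1}/herm map_octl octl_octr mulmxA mxE; apply: eq_bigr => k _.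
rewrite rE [X in _ * X = _]mxE [(\col__ _) _ _]mxE.
rewrite -[X in _ * X = _]/(conjc (lcoef k * toC (x 0 k))) conjcM conjc_toC.
by rewrite mulrA [RHS]mulrC; congr (_ * _); exact: mulrC.
Qed.

(** Each coordinate is real because $H(x)$ is Hermitian. *)
Lemma psiE z k : toC (psi z k 0) =
  conjc (lcoef k) * ((octr z)^T *m conjmx z) k 0.
Proof.
set c := RHS; rewrite mxE -/c.
have := herm_form_real (delta_mx 0 k) z; rewrite herm_form.
rewrite (bigD1 k)//= mxE !eqxx mul1r big1 ?addr0 => [|j /negbTE jk]; last first.
  by rewrite mxE jk andbF mul0r.
rewrite -/c; case: c => a b [] /eqP; rewrite -addr_eq0 -mulr2n mulrn_eq0 /=.
by move=> /eqP ->.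
Qed.

Lemma herm_psi x z : ((conjmx z)^T *m conjmx (herm x) *m z) 0 0 =
  toC ((x *m psi z) 0 0).
Proof.
rewrite herm_form mxE rmorph_sum /=; apply: eq_bigr => k _.
by rewrite rmorphM /= psiE.
Qed.

(** Substituting $H(xA) = g H(x) g^*$, the factors introduced by $g$ cancel because
    $g^* \bar g = 1$ and $g^T g = 1$. *)
Lemma psi_lifts_dot g A x z : g^T *m g = 1%:M -> lifts g A ->
  ((x *m A) *m psi (g *m z)) 0 0 = (x *m psi z) 0 0.
Proof.
move=> gg gA.
apply: complexI; transitivity (((conjmx (g *m z))^T *m
  conjmx (herm (x *m A)) *m (g *m z)) 0 0); first by rewrite herm_psi.
rewrite -gA -[RHS]herm_psi !conjmxM -map_trmx conjmxK trmx_mul.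
have cgg : (conjmx g)^T *m conjmx g = 1%:M.
  by rewrite map_trmx -conjmxM gg map_mx1.
by rewrite !mulmxA -(mulmxA _ _ (conjmx g)) cgg mulmx1 -(mulmxA _ _ g) gg mulmx1.
Qed.

Definition hnorm z : R := \sum_k (complex.Re (z k 0) ^+ 2 + complex.Im (z k 0) ^+ 2).

Lemma psi0 z : psi z 0 0 = hnorm z.
Proof.
apply: complexI; rewrite psiE /lcoef eqxx conjc1 mul1r mxE /hnorm rmorph_sum /=.
apply: eq_bigr => k _.
have -> : (octr z)^T 0 k = z k 0 by rewrite -{2}(col0_octr z) !mxE.
by rewrite mxE; case: (z k 0) => a b; simpc; rewrite -!expr2 mulrC addNr.
Qed.

(** Up to factors $i$ the covector is $R_z^T \bar z$, and
    $R_z R_z^T = (z \cdot z) I = I$. *)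
Lemma qf_psi z : sqnorm z = 1 -> qf lorentz (psi z)^T = 1.
Proof.
move=> z1; apply: complexI; rewrite qf_lorentz rmorph_sum /= rmorph1.
pose r := (octr z)^T *m conjmx z.
transitivity ((r^T *m r) 0 0).
  rewrite [RHS]mxE; apply: eq_bigr => k _.
  rewrite rmorphM rmorphXn /= [_^T 0 k]mxE psiE -/r exprMn [r^T _ _]mxE -expr2.
  rewrite mulrA -[RHS]mul1r; congr (_ * _); rewrite /lcoef.
  by case: (k == 0); simpc; rewrite ?expr1n ?mulr1//= expr2; simpc.
rewrite /r trmx_mul trmxK -mulmxA (mulmxA (octr z)) octr_mulmx_tr z1 mul1mx.
rewrite mxE -[1]conjc1 -z1 /sqnorm rmorph_sum /=; apply: eq_bigr => k _.
by rewrite !mxE rmorphXn expr2.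
Qed.


Lemma lifts1 : lifts 1%:M 1%:M.
Proof. by move=> x; rewrite map_mx1 trmx1 !mulmx1 mul1mx. Qed.

Lemma lifts_mul g h A B : lifts g A -> lifts h B -> lifts (g *m h) (B *m A).
Proof.
move=> gA hB x; rewrite conjmxM trmx_mul !mulmxA -gA -hB.
by rewrite !mulmxA.
Qed.

Lemma conj_orth g : g^T *m g = 1%:M -> (conjmx g)^T *m conjmx g = 1%:M.
Proof. by move=> gg; rewrite map_trmx -conjmxM gg map_mx1. Qed.

Lemma lifts_inv g A : g^T *m g = 1%:M -> A \in unitmx -> lifts g A ->
  lifts g^T (invmx A).
Proof.
move=> gg Au gA x; rewrite -{1}[x](mulmxKV Au) -gA -map_trmx trmxK !mulmxA.
by rewrite gg mul1mx -mulmxA conj_orth// mulmx1.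
Qed.

Lemma qf_lorentz_lifts g A x : g^T *m g = 1%:M -> lifts g A ->
  qf lorentz (x *m A) = qf lorentz x.
Proof.
move=> gg gA; apply: complexI.
have : (herm (x *m A) *m (herm (x *m A))^T) = (toC (qf lorentz x))%:M.
  rewrite herm_tr -gA !conjmxM -map_trmx conjmxK !mulmxA.
  rewrite -(mulmxA _ _ (conjmx g)) conj_orth// mulmx1 -(mulmxA g) -herm_tr.
  by rewrite herm_mul_tr mul_mx_scalar -scalemxAl (mulmx1C gg) scalemx1.
rewrite herm_mul_tr => /matrixP/(_ 0 0).
by rewrite !mxE !mulr1n.
Qed.

Lemma eq_cols (M N : 'M[C]_8) :
  (forall j, M *m delta_mx j 0 = N *m delta_mx j 0 :> 'cV[C]_8) -> M = N.
Proof.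
move=> e; apply/matrixP => i j.
by have /colP/(_ i) := e j; rewrite -!colE !mxE.
Qed.

(** Such a $g$ is unitary as it fixes $H(e_0) = I$, so it is real and commutes with all
    left multiplications.  Hence it is the right multiplication by $g e_0$, and
    $g e_0$ lies in the nucleus of the octonions. *)
Lemma lifts_id g : g^T *m g = 1%:M -> lifts g 1%:M -> g = 1%:M \/ g = - 1%:M.
Proof.
move=> gg g1; have ggT := mulmx1C gg.
have herm1 : herm (delta_mx 0 0) = 1%:M.
  rewrite -octl1; congr octl; apply/matrixP => i j; rewrite !mxE ord1 eqxx andbT.
  by rewrite /lcoef; case: (i == 0); rewrite ?mul1r ?mulr0.
have gconj : (conjmx g)^T = g^T.
  have := g1 (delta_mx 0 0); rewrite mulmx1 herm1 mulmx1 => gg'.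
  by rewrite -[LHS]mul1mx -gg -mulmxA gg' mulmx1.
have comm j : g *m octl (delta_mx j 0) = octl (delta_mx j 0) *m g.
  have hj : herm (delta_mx 0 j) = lcoef j *: octl (delta_mx j 0).
    rewrite -octlZ; congr octl; apply/matrixP => i k; rewrite !mxE ord1 eqxx /=.
    by rewrite andbT; case: eqP => [->|]; rewrite ?mulr1 ?mulr0.
  have := g1 (delta_mx 0 j); rewrite mulmx1 hj gconj -scalemxAr -scalemxAl.
  move=> /(scalerI (lcoef_neq0 j)) e.
  by rewrite -[RHS](congr1 (mulmx^~ g) e) -mulmxA gg mulmx1.
pose u := col 0 g.
have gE : g = octr u.
  apply: eq_cols => j.
  by rewrite -octl_octr /u colE mulmxA -comm -mulmxA -[octl _ *m _]colE col0_octl.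
have u0 k : k != 0 -> u k 0 = 0.
  apply: octr_comm_octl => [j|]; first by rewrite -gE comm.
  by apply/rregP; rewrite pnatr_eq0.
have {}gE : g = (u 0 0)%:M.
  have uE : u = u 0 0 *: delta_mx 0 0.
    apply/colP => i; rewrite [RHS]mxE [X in _ * X]mxE.
    by have [->|/u0 ->] := eqVneq i 0; rewrite ?eqxx ?mulr1 ?mulr0.
  apply: eq_cols => j; rewrite mul_scalar_mx {1}gE.
  by rewrite -octl_octr {1}uE -scalemxAr -colE col0_octl.
move: gg; rewrite gE tr_scalar_mx -scalar_mxM => /matrixP/(_ 0 0).
rewrite !mxE !mulr1n -expr2 => /eqP; rewrite sqrf_eq1 => /orP[]/eqP ->.
  by left.
by right; apply/matrixP => i j; rewrite !mxE mulNrn.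
Qed.

(** Two lifts of the same isometry differ by a lift of the identity. *)
Lemma lifts_uniq g h A : g^T *m g = 1%:M -> h^T *m h = 1%:M -> A \in unitmx ->
  lifts g A -> lifts h A -> h = g \/ h = - g.
Proof.
move=> gg hh Au gA hA.
have k1 : lifts (g^T *m h) 1%:M.
  by rewrite -(mulmxV Au); apply: lifts_mul hA; exact: lifts_inv.
have kk : (g^T *m h)^T *m (g^T *m h) = 1%:M.
  by rewrite trmx_mul trmxK mulmxA -(mulmxA _ g) (mulmx1C gg) mulmx1.
have hE : h = g *m (g^T *m h) by rewrite mulmxA (mulmx1C gg) mul1mx.
case: (lifts_id kk k1) => e; rewrite hE e ?mulmx1; first by left.
by right; rewrite mulmxN mulmx1.
Qed.

(** The positive definite form obtained from the Lorentz form by changing its sign on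
    the hyperplane orthogonal to the timelike vector of $z$. *)
Definition hyp z : 'M[R]_8 := 2 *: (psi z *m (psi z)^T) - lorentz.

Lemma qf_hyp z x : qf (hyp z) x = 2 * (x *m psi z) 0 0 ^+ 2 - qf lorentz x.
Proof.
have -> : qf (hyp z) x =
    (2 *: ((x *m psi z) *m (x *m psi z)^T) - x *m lorentz *m x^T) 0 0.
  by rewrite /qf /hyp mulmxBr mulmxBl -scalemxAr -scalemxAl trmx_mul !mulmxA.
rewrite (mx11_scalar (x *m psi z)) tr_scalar_mx -scalar_mxM.
have entry (a : R) (b : 'M[R]_1) : (2 *: a%:M - b) 0 0 = 2 * a - b 0 0.
  by rewrite !mxE mulr1n.
by rewrite entry [_%:M 0 0]mxE mulr1n expr2.
Qed.

Lemma qf_hyp_lifts g A x z : g^T *m g = 1%:M -> lifts g A ->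
  qf (hyp (g *m z)) (x *m A) = qf (hyp z) x.
Proof.
move=> gg gA; have e := psi_lifts_dot x z gg gA.
have n := qf_lorentz_lifts x gg gA.
transitivity (2 * ((x *m A) *m psi (g *m z)) 0 0 ^+ 2 - qf lorentz (x *m A)).
  exact: qf_hyp.
transitivity (2 * (x *m psi z) 0 0 ^+ 2 - qf lorentz x); last exact/esym/qf_hyp.
have eq2 (a a' b b' : R) : a = a' -> b = b' -> 2 * a ^+ 2 - b = 2 * a' ^+ 2 - b'.
  by move=> -> ->.
exact: (eq2 _ _ _ _ e n).
Qed.

Lemma cauchy_schwarz (I : finType) (P : pred I) (u v : I -> R) :
  (\sum_(i | P i) u i * v i) ^+ 2 <=
  (\sum_(i | P i) u i ^+ 2) * (\sum_(i | P i) v i ^+ 2).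
Proof.
set d := \sum_(i | P i) u i * v i; set p := \sum_(i | P i) u i ^+ 2.
set q := \sum_(i | P i) v i ^+ 2.
have q0 : 0 <= q by apply: sumr_ge0 => i _; exact: sqr_ge0.
have h : 0 <= q * (p * q - d ^+ 2).
  have -> : q * (p * q - d ^+ 2) = \sum_(i | P i) (q * u i - d * v i) ^+ 2.
    transitivity (\sum_(i | P i) (q ^+ 2 * u i ^+ 2 +
        ((- 2 * q * d) * (u i * v i) + d ^+ 2 * v i ^+ 2))).
      by rewrite !big_split /= -!mulr_sumr -/p -/q -/d; ring.
    by apply: eq_bigr => i _; ring.
  by apply: sumr_ge0 => i _; exact: sqr_ge0.
have [qp|qn] := ltP 0 q; first by rewrite -subr_ge0 -(pmulr_rge0 _ qp).
have qz : q = 0 by apply/le_anti; rewrite qn.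
have vz i : P i -> v i = 0.
  move=> Pi; apply/eqP; rewrite -sqrf_eq0; apply/eqP.
  by apply: (psumr_eq0P _ qz) Pi => j _; exact: sqr_ge0.
rewrite qz mulr0 /d big1 ?expr0n// => i /vz ->; exact: mulr0.
Qed.

Lemma qf_lorentz_split x :
  qf lorentz x = x 0 0 ^+ 2 - \sum_(k | k != 0) x 0 k ^+ 2.
Proof.
rewrite qf_lorentz (bigD1 0)//= mul1r -sumrN; congr (_ + _).
by apply: eq_bigr => k /negbTE ->; rewrite mulN1r.
Qed.

Lemma psi_hyperboloid z : sqnorm z = 1 ->
  psi z 0 0 ^+ 2 - \sum_(k | k != 0) psi z k 0 ^+ 2 = 1.
Proof.
move=> /qf_psi <-; rewrite qf_lorentz_split [_^T _ _]mxE; congr (_ - _).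
by apply: eq_bigr => k _; rewrite [_^T _ _]mxE.
Qed.

(** The reversed Cauchy-Schwarz inequality, the covector of $z$ being timelike. *)
Lemma qf_lorentz_le z x : sqnorm z = 1 -> qf lorentz x <= (x *m psi z) 0 0 ^+ 2.
Proof.
move=> /psi_hyperboloid z1.
rewrite qf_lorentz_split [(x *m _) 0 0]mxE [X in _ <= X ^+ 2](bigD1 0)//=.
move: z1.
have := @cauchy_schwarz _ (fun k : 'I_8 => k != 0) (fun k => x 0 k)
  (fun k => psi z k 0).
set a := x 0 0; set p := psi z 0 0.
set b := \sum_(i | _) x 0 i ^+ 2; set q := \sum_(i | _) psi z i 0 ^+ 2.
set d := \sum_(i | _) _ * _.
have q0 : 0 <= q by apply: sumr_ge0 => i _; exact: sqr_ge0.
have b0 : 0 <= b by apply: sumr_ge0 => i _; exact: sqr_ge0.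
move=> dbq pq.
have p2 : p ^+ 2 = 1 + q by lra.
rewrite -subr_ge0.
have [qp|qn] := ltP 0 q.
  rewrite -(pmulr_rge0 _ qp).
  have : q * ((a * p + d) ^+ 2 - (a ^+ 2 - b)) =
    (a * q + p * d) ^+ 2 + (b * q - d ^+ 2) +
      (p ^+ 2 - 1 - q) * (a ^+ 2 * q - d ^+ 2) by ring.
  rewrite p2 => ->; have := sqr_ge0 (a * q + p * d); lra.
have qz : q = 0 by apply/le_anti; rewrite qn.
have dz : d = 0 by apply/eqP; rewrite -sqrf_eq0 eq_le sqr_ge0 andbT (le_trans dbq)// qz mulr0.
by rewrite dz addr0 exprMn p2 qz; lra.
Qed.

Lemma hyp_ge z x : sqnorm z = 1 -> `|qf lorentz x| <= qf (hyp z) x.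
Proof.
move=> /(qf_lorentz_le x) h; rewrite qf_hyp ler_norml.
by have := sqr_ge0 ((x *m psi z) 0 0); lra.
Qed.

Lemma hyp_tr z : (hyp z)^T = hyp z.
Proof. by rewrite linearB linearZ /= trmx_mul trmxK lorentz_tr. Qed.

(** The product of the two forms is, up to sign, a reflection. *)
Lemma hyp_lorentz_sq z : sqnorm z = 1 ->
  hyp z *m lorentz *m hyp z *m lorentz = 1%:M.
Proof.
move=> /qf_psi z1; rewrite -mulmxA.
have -> : hyp z *m lorentz = 2 *: (psi z *m (psi z)^T *m lorentz) - 1%:M.
  by rewrite mulmxBl lorentz_sq -scalemxAl.
set P := psi z *m _ *m _.
have t1 : (psi z)^T *m lorentz *m psi z = 1%:M.
  by rewrite [LHS]mx11_scalar -z1 /qf trmxK.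
have PP : P *m P = P.
  transitivity (psi z *m ((psi z)^T *m lorentz *m psi z) *m (psi z)^T *m lorentz).
    by rewrite /P !mulmxA.
  by rewrite t1 mulmx1.
rewrite mulmxBr !mulmxBl -scalemxAl -scalemxAr PP !mul1mx !mulmx1 scalerA.
rewrite -scalerBl opprB addrCA -scalerBl (_ : 2 * 2 - 2 - 2 = 0); last by ring.
by rewrite scale0r addr0.
Qed.

Lemma det_hyp z : sqnorm z = 1 -> `|\det (hyp z)| = 1.
Proof.
move=> /hyp_lorentz_sq/(congr1 determinant); rewrite !det_mulmx det1 => e.
have : (\det lorentz) ^+ 2 = 1 by rewrite expr2 -det_mulmx lorentz_sq det1.
move=> l1; apply/eqP; rewrite -(@eqrXn2 _ 2)// expr1n -normrX ger0_norm ?sqr_ge0//.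
by apply/eqP; rewrite -[LHS]mulr1 -{1}l1 -e; ring.
Qed.

(** The inverse of the form is its conjugate by the Lorentz matrix.  Hence $x_k$ is the
    scalar product of $x$ with a vector $y$ whose length is the $k$-th diagonal
    entry, and the bound is positivity of the form at $x \pm y$. *)
Lemma hyp_coord z x k : sqnorm z = 1 ->
  2 * `|x 0 k| <= qf (hyp z) x + hyp z k k.
Proof.
move=> z1; pose e : 'rV[R]_8 := delta_mx 0 k.
have pos y : 0 <= qf (hyp z) y by exact: le_trans (hyp_ge y z1).
pose y := e *m lorentz *m hyp z *m lorentz.
have My : hyp z *m y^T = e^T.
  rewrite /y !trmx_mul hyp_tr lorentz_tr !mulmxA hyp_lorentz_sq//.
  exact: mul1mx.
have coord (u : 'rV[R]_8) : (u *m e^T) 0 0 = u 0 k.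
  by rewrite /e trmx_delta -colE mxE.
have xy : (x *m hyp z *m y^T) 0 0 = x 0 k by rewrite -mulmxA My coord.
have yy : qf (hyp z) y = hyp z k k.
  rewrite /qf -mulmxA My coord /y /e -!mulmxA -rowE mxE.
  rewrite /lorentz mul_diag_mx mxE mul_mx_diag !mxE.
  by case: (k == 0); rewrite ?mulN1r ?mulrN1 ?opprK ?mul1r ?mulr1.
have := pos (x + y); have := pos (x - y).
rewrite (qfB_sym _ _ (hyp_tr z)) (qfD_sym _ _ (hyp_tr z)) xy yy => h1 h2.
by case: (ler0P (x 0 k)); lra.
Qed.

Lemma hyp_diag z k : sqnorm z = 1 -> hyp z k k <= 2 * hnorm z ^+ 2 + 1.
Proof.
move=> z1; have -> : hyp z k k = 2 * psi z k 0 ^+ 2 - lorentz k k.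
  have entry (a b : 'M[R]_8) : (2 *: a - b) k k = 2 * a k k - b k k by rewrite !mxE.
  rewrite entry; congr (2 * _ - _).
  by rewrite mxE big_ord_recl big_ord0 addr0 [_^T _ _]mxE -expr2 ord1.
have lk : -1 <= lorentz k k.
  by rewrite /lorentz !mxE eqxx mulr1n; case: (k == 0); lra.
move: lk; have := psi_hyperboloid z1; rewrite -psi0.
have [->|k0] := eqVneq k 0; first by lra.
rewrite (bigD1 k)//=.
have : 0 <= \sum_(i | (i != 0) && (i != k)) psi z i 0 ^+ 2.
  by apply: sumr_ge0 => i _; exact: sqr_ge0.
by have := sqr_ge0 (psi z k 0); lra.
Qed.

Lemma hnorm_ge1 z : sqnorm z = 1 -> 1 <= hnorm z.
Proof.
move=> z1; rewrite -psi0; have := psi_hyperboloid z1.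
have : 0 <= \sum_(k | k != 0) psi z k 0 ^+ 2.
  by apply: sumr_ge0 => i _; exact: sqr_ge0.
have : 0 <= psi z 0 0.
  by rewrite psi0; apply: sumr_ge0 => i _; rewrite addr_ge0 ?sqr_ge0.
by nra.
Qed.

(** * Lifting Lorentz isometries to the spin group *)

Definition reflection w : 'M[R]_8 :=
  1%:M - (2 / qf lorentz w) *: (lorentz *m w^T *m w).

Lemma mul_reflection x w : x *m reflection w =
  x - (2 * (x *m lorentz *m w^T) 0 0 / qf lorentz w) *: w.
Proof.
rewrite mulmxBr mulmx1 -scalemxAr !mulmxA.
by rewrite [X in X *m w]mx11_scalar mul_scalar_mx scalerA mulrAC.
Qed.

Lemma reflectionK w : qf lorentz w != 0 -> reflection w *m reflection w = 1%:M.
Proof.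
move=> w0; apply/row_matrixP => i; rewrite !rowE mulmxA !mul_reflection.
set e := delta_mx 0 i; set a := (e *m _ *m _) 0 0.
have -> : ((e - (2 * a / qf lorentz w) *: w) *m lorentz *m w^T) 0 0 = - a.
  have entry (p q : 'M[R]_1) c : (p - c *: q) 0 0 = p 0 0 - c * q 0 0 by rewrite !mxE.
  rewrite !mulmxBl -!scalemxAl entry -/a -/(qf lorentz w); field.
  exact: w0.
rewrite mulmx1 mulrN mulNr scaleNr opprK; exact: subrK.
Qed.

Lemma reflection_isom w : qf lorentz w != 0 ->
  reflection w *m lorentz *m (reflection w)^T = lorentz.
Proof.
move=> w0; have e : lorentz *m (reflection w)^T = reflection w *m lorentz.
  rewrite /reflection linearB linearZ /= trmx1 mulmxBr mulmxBl mulmx1 mul1mx.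
  by rewrite !trmx_mul trmxK lorentz_tr -scalemxAr -scalemxAl !mulmxA.
by rewrite -mulmxA e mulmxA reflectionK// mul1mx.
Qed.

Definition special_orth g := g^T *m g = 1%:M /\ \det g = 1.

(** Polarising $H(x) H(x)^T = n(x)$ gives
    $H(w) \overline{H(x)} H(w) = 2 \langle x, w \rangle H(w) - n(w) H(x)$, which for
    $n(w) = -1$ is the reflection of $x$ in $w$.  The factor $i$ in $h = i H(w)$ makes
    $h$ orthogonal. *)
Lemma reflection_lift w : qf lorentz w < 0 -> exists2 h, special_orth h &
  forall x, h *m conjmx (herm x) *m (conjmx h)^T = herm (x *m reflection w).
Proof.
move=> w0; pose a := Num.sqrt (- (qf lorentz w)^-1).
have a2 : a ^+ 2 = - (qf lorentz w)^-1 by rewrite sqr_sqrtr// oppr_ge0 invr_le0 ltW.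
pose v := 'i%C *: \col_k (lcoef k * toC ((a *: w) 0 k)).
have sqv : sqnorm v = 1.
  rewrite /sqnorm; transitivity (- toC (qf lorentz (a *: w))).
    rewrite qf_lorentz rmorph_sum -sumrN; apply: eq_bigr => k _.
    rewrite [v _ _]mxE [X in _ * X]mxE !exprMn sqr_i mulN1r; congr (- _).
    rewrite rmorphM rmorphXn /=; congr (_ * _).
    by rewrite /lcoef; case: (k == 0); rewrite ?expr1n ?sqr_i ?rmorphN ?rmorph1.
  by rewrite qfZ a2 mulNr mulVf ?lt_eqF// rmorphN rmorph1 opprK.
have hE : octl v = 'i%C *: herm (a *: w) by rewrite octlZ.
exists (octl v) => [|x].
  split; last by rewrite det_octl ?pnatr_eq0// sqv expr1n.
  by apply: mulmx1C; rewrite octl_mulmx_tr sqv.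
have hstar : (conjmx (octl v))^T = - 'i%C *: herm (a *: w).
  rewrite hE; apply/trmx_inj; rewrite trmxK linearZ /= herm_tr.
  by apply/matrixP => i j; rewrite !mxE conjcM; congr (_ * _); simpc.
rewrite hstar hE -scalemxAl -scalemxAr -scalemxAl scalerA.
have -> : - 'i%C * 'i%C = 1 :> C by rewrite mulNr -expr2 sqr_i opprK.
rewrite scale1r hermZ -!scalemxAl -scalemxAr scalerA -rmorphM -expr2 a2.
have := herm_polar w x; move/(congr1 (mulmx^~ (herm w))).
rewrite mulmxDl -[herm x *m _ *m _]mulmxA.
have -> : conjmx (herm w) *m herm w = (toC (qf lorentz w))%:M.
  transitivity (conjmx (herm w *m (herm w)^T)).
    by rewrite conjmxM herm_tr conjmxK.
  by rewrite herm_mul_tr map_scalar_mx; congr (_%:M); exact: conjc_toC.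
rewrite mul_mx_scalar mul_scalar_mx => /(canRL (addrK _)) ->.
rewrite mul_reflection hermB hermZ lorentz_sym.
set t := (x *m _ *m _) 0 0; set n := qf lorentz w.
have n0 : n != 0 by rewrite lt_eqF.
have c1 : toC (- n^-1) * toC n = -1.
  by rewrite -(rmorphM toC) mulNr mulVf// rmorphN rmorph1.
have c2 : toC (- n^-1) * (2 * toC t) = - toC (2 * t / n).
  by rewrite -(rmorph_nat toC) -!(rmorphM toC) -(rmorphN toC); congr (toC _); ring.
by rewrite scalerBr !scalerA c1 c2 scaleN1r opprK scaleNr addrC.
Qed.

(** Products of an even or odd number of reflections in spacelike vectors: each
    reflection introduces a complex conjugation. *)
Definition spin_kind (odd : bool) A := exists2 g, special_orth g &
  forall x, g *m (if odd then conjmx (herm x) else herm x) *m (conjmx g)^T =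
    herm (x *m A).

Lemma spin_kind1 : spin_kind false 1%:M.
Proof.
exists 1%:M; first by split; rewrite ?det1// trmx1 mulmx1.
exact: lifts1.
Qed.

Lemma spin_kind_reflection odd A w : qf lorentz w < 0 -> spin_kind odd A ->
  spin_kind (~~ odd) (A *m reflection w).
Proof.
move=> w0 [g [gg g1] gA]; have [h [hh h1] hw] := reflection_lift w0.
exists (h *m conjmx g).
  split; last by rewrite det_mulmx h1 det_map_mx g1 mul1r rmorph1.
  rewrite trmx_mul mulmxA -(mulmxA _ h^T) hh mulmx1 map_trmx -conjmxM gg.
  by rewrite map_mx1.
move=> x; rewrite mulmxA -hw -gA !conjmxM -map_trmx conjmxK trmx_mul !mulmxA.
by rewrite (fun_if (map_mx (@conjc R))) conjmxK; clear gA; case: odd.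
Qed.

Lemma spacelike_lt0 w : w 0 0 = 0 -> w != 0 -> qf lorentz w < 0.
Proof.
move=> w0 wn0; rewrite qf_lorentz_split w0 expr0n sub0r oppr_lt0 lt_neqAle.
have ge0 : 0 <= \sum_(k : 'I_8 | k != 0) w 0 k ^+ 2.
  by apply: sumr_ge0 => i _; exact: sqr_ge0.
rewrite ge0 andbT; apply: contra_neq wn0 => /esym s0; apply/rowP => k.
rewrite mxE; have [->//|k0] := eqVneq k 0.
apply/eqP; rewrite -sqrf_eq0; apply/eqP.
by apply: (psumr_eq0P _ s0) k0 => i _; exact: sqr_ge0.
Qed.

Lemma gram_entry m n (A : 'M[R]_(m, n)) (S : 'M[R]_n) j l :
  (row j A *m S *m (row l A)^T) 0 0 = (A *m S *m A^T) j l.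
Proof.
rewrite -row_mul tr_row [LHS]mxE [RHS]mxE; apply: eq_bigr => k _.
by rewrite [row _ _ _ _]mxE [col _ _ _ _]mxE.
Qed.

(** Reflections restore one basis vector after the other (Cartan and Dieudonne).  The
    first reflection needs that $A$ preserves the direction of time, which makes
    $e_0 - e_0 A$ spacelike; the later vectors are orthogonal to $e_0$. *)
Lemma orthochronous_spin_kind k A : (k <= 8)%N ->
  A *m lorentz *m A^T = lorentz -> 0 < A 0 0 ->
  (forall i : 'I_8, (i < 8 - k)%N -> row i A = delta_mx 0 i) ->
  exists odd, spin_kind odd A.
Proof.
elim: k A => [|k IH] A k8 Aiso A00 Afix.
  exists false; have -> : A = 1%:M; last exact: spin_kind1.
  by apply/row_matrixP => i; rewrite Afix ?rowE ?mulmx1// subn0.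
have i8 : (8 - k.+1 < 8)%N by rewrite ltn_subrL.
pose i : 'I_8 := Ordinal i8.
pose w : 'rV[R]_8 := delta_mx 0 i - row i A.
have [w0|wn0] := eqVneq w 0.
  apply: (IH A) => // [|j]; first exact: ltnW.
  rewrite -subSS subSn// ltnS leq_eqVlt => /orP[/eqP ji|]; last exact: Afix.
  have -> : j = i by exact: val_inj.
  by apply/esym/eqP; rewrite -subr_eq0; apply/eqP.
have AisoE j l : (row j A *m lorentz *m (row l A)^T) 0 0 = lorentz j l.
  by rewrite gram_entry Aiso.
have eE (l : 'I_8) (u : 'rV[R]_8) :
    (u *m lorentz *m (delta_mx 0 l : 'rV[R]_8)^T) 0 0 = lorentz l l * u 0 l.
  by rewrite trmx_delta -colE mxE mul_mx_diag !mxE eqxx mulr1n mulrC.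
have lne j l : j != l -> lorentz j l = 0 by move=> /negbTE jl; rewrite !mxE jl.
have leq j : lorentz j j = if j == 0 then 1 else -1 by rewrite !mxE eqxx mulr1n.
have wfix (j : 'I_8) : (j < i)%N -> (row j A *m lorentz *m w^T) 0 0 = 0.
  move=> ji; have nji : j != i by rewrite neq_ltn ji.
  have entry (p q : 'M[R]_1) : (p - q) 0 0 = p 0 0 - q 0 0 by rewrite !mxE.
  rewrite /w linearB mulmxBr entry AisoE (Afix j ji) eE.
  by rewrite [delta_mx _ _ _ _]mxE (eq_sym i) (negbTE nji) andbF mulr0 lne// subrr.
have w_lt0 : qf lorentz w < 0.
  have [i0|ipos] := eqVneq i 0; last first.
    apply: spacelike_lt0 => //; have i_gt0 : (0 < i)%N by rewrite lt0n.
    have := @wfix 0 i_gt0; rewrite (Afix 0)// (lorentz_sym _ w) eE leq eqxx mul1r.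
    exact.
  have nE : qf lorentz w = 2 - 2 * A 0 0.
    rewrite /w i0 (qfB_sym _ _ lorentz_tr) lorentz_sym eE /qf AisoE eE !leq eqxx.
    by rewrite !mxE !eqxx !mul1r mulr1n; ring.
  have := AisoE 0 0; rewrite -/(qf lorentz _) qf_lorentz_split leq eqxx mxE => A1.
  have : 0 <= \sum_(k : 'I_8 | k != 0) row 0 A 0 k ^+ 2.
    by apply: sumr_ge0 => j _; exact: sqr_ge0.
  have [A00'|] := eqVneq (A 0 0) 1; last by rewrite nE; nra.
  move=> _; apply: spacelike_lt0 => //.
  by rewrite /w i0 !mxE eqxx A00' subrr.
have w_neq0 : qf lorentz w != 0 by rewrite lt_eqF.
pose B := A *m reflection w.
have Biso : B *m lorentz *m B^T = lorentz.
  rewrite /B trmx_mul mulmxA -2!(mulmxA A) reflection_isom//.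
have Bfix (j : 'I_8) : (j < 8 - k)%N -> row j B = delta_mx 0 j.
  rewrite -subSS subSn// ltnS leq_eqVlt /B row_mul mul_reflection => /orP[/eqP ji|ji].
    have -> : j = i by exact: val_inj.
    have e1 : 2 * (row i A *m lorentz *m w^T) 0 0 = - qf lorentz w.
      have entry (p q : 'M[R]_1) : (p - q) 0 0 = p 0 0 - q 0 0 by rewrite !mxE.
      rewrite {1}/w linearB mulmxBr entry AisoE eE.
      rewrite /w (qfB_sym _ _ lorentz_tr) lorentz_sym eE /qf AisoE eE.
      by rewrite [delta_mx _ _ _ _]mxE !eqxx mulr1; ring.
    rewrite e1 mulNr mulfV// scaleN1r opprK /w addrC; exact: subrK.
  by rewrite wfix// mulr0 mul0r scale0r subr0 Afix.
have B00 : 0 < B 0 0.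
  have := @Bfix 0; rewrite subn_gt0 => /(_ k8)/rowP/(_ 0).
  by rewrite !mxE eqxx => ->.
have [odd Bodd] := IH B (ltnW k8) Biso B00 Bfix.
exists (~~ odd); have -> : A = B *m reflection w.
  by rewrite /B -mulmxA reflectionK// mulmx1.
exact: spin_kind_reflection.
Qed.

(** If $A$ reverses the direction of time, $-A$ preserves it. *)
Lemma lorentz_spin_kind A : A *m lorentz *m A^T = lorentz ->
  exists (flip odd : bool), spin_kind odd ((-1) ^+ flip *: A).
Proof.
move=> Aiso.
have sgn2 (s : bool) : (-1) ^+ s * (-1) ^+ s = 1 :> R by rewrite -expr2 sqrr_sign.
exists (A 0 0 < 0); apply: (@orthochronous_spin_kind 8) => //.
- by rewrite linearZ /= -!scalemxAl -scalemxAr scalerA sgn2 scale1r.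
- have : 1 <= A 0 0 ^+ 2.
    have := congr1 (fun M : 'M[R]_8 => M 0 0) Aiso.
    rewrite -gram_entry -/(qf _ _) qf_lorentz_split !mxE eqxx mulr1n.
    have : 0 <= \sum_(k : 'I_8 | k != 0) row 0 A 0 k ^+ 2.
      by apply: sumr_ge0 => j _; exact: sqr_ge0.
    by lra.
  move=> A1; rewrite mxE; have [h|h] := ltP (A 0 0) 0.
    by rewrite expr1 mulN1r oppr_gt0.
  rewrite expr0 mul1r lt_neqAle h andbT eq_sym; apply: contraTneq A1 => ->.
  by rewrite expr0n ler10.
Qed.

(** In the quotient of two isometries of the same kind the signs and the
    conjugations cancel. *)
Lemma spin_kind_ratio odd A B (s : R) : s != 0 -> A \in unitmx ->
  spin_kind odd (s *: A) -> spin_kind odd (s *: B) ->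
  exists2 g, special_orth g & lifts g (invmx A *m B).
Proof.
move=> s0 Au [g [gg g1] gA] [h [hh h1] hB]; exists (h *m g^T).
  split; last by rewrite det_mulmx det_tr g1 h1 mulr1.
  by rewrite trmx_mul trmxK mulmxA -(mulmxA g) hh mulmx1 mulmx1C.
move=> x; pose y := s^-1 *: (x *m invmx A).
have -> : x *m (invmx A *m B) = y *m (s *: B).
  by rewrite /y -scalemxAl -scalemxAr scalerA mulVf// scale1r mulmxA.
have xE : x = y *m (s *: A).
  by rewrite /y -scalemxAl -scalemxAr scalerA mulVf// scale1r mulmxKV.
rewrite -hB {1}xE -gA conjmxM trmx_mul -map_trmx trmxK !mulmxA.
rewrite -(mulmxA h) gg mulmx1 -(mulmxA _ _ (conjmx g)) conj_orth//.
by rewrite mulmx1.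
Qed.

End Spin.

(** * The lattice $\mathbb Z[\sqrt 2]^8$ *)

Section Lattice.
Variable R : realType.
Local Notation C := R[i].
Implicit Types (z : 'cV[C]_8) (N U : 'M[int]_(8 + 8)) (v : 'rV[int]_(8 + 8)).
Local Notation J := (lorentz R).

Definition sqrt2 : R := Num.sqrt 2.
Definition root4 : R := Num.sqrt sqrt2.

Lemma sqrt2_sq : sqrt2 ^+ 2 = 2. Proof. by rewrite sqr_sqrtr. Qed.
Lemma sqrt2_gt1 : 1 < sqrt2.
Proof. by rewrite -sqrtr1 ltr_sqrt// ltr1n. Qed.
Lemma root4_sq : root4 ^+ 2 = sqrt2.
Proof. by rewrite sqr_sqrtr// sqrtr_ge0. Qed.
Lemma root4_ge1 : 1 <= root4.
Proof. by rewrite -sqrtr1 ler_wsqrtr// ltW// sqrt2_gt1. Qed.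

Lemma sqr_eq_double (a b : int) : a ^+ 2 = 2 * b ^+ 2 -> b = 0.
Proof.
move=> /(congr1 absz); rewrite abszM !abszX => ab.
apply/eqP; rewrite -absz_eq0; move: `|a|%N `|b|%N ab => {a}m {b}n /= mn.
apply/negP => /negP; rewrite -lt0n => n0.
have m0 : (0 < m)%N.
  have : (0 < m ^ 2)%N by rewrite mn muln_gt0 expn_gt0 n0.
  by rewrite expn_gt0 orbF.
have n20 : (0 < n ^ 2)%N by rewrite expn_gt0 n0.
have : logn 2 (m ^ 2) = (1 + 2 * logn 2 n)%N.
  by rewrite mn lognM// lognX logn_prime.
by rewrite lognX => /(congr1 odd); rewrite oddD !oddM.
Qed.

Lemma int_sqrt2_eq0 (a b : int) : a%:~R = sqrt2 * b%:~R -> a = 0 /\ b = 0.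
Proof.
move=> e; have b0 : b = 0.
  apply: (@sqr_eq_double a); apply/eqP; rewrite -(eqr_int R) !expr2 !intrM.
  by rewrite e mulrACA -expr2 sqrt2_sq.
by split=> //; move/eqP: e; rewrite b0 mulr0 intr_eq0 => /eqP.
Qed.

Definition lat_scale k : R := if k == 0 :> 'I_8 then root4 else 1.

Lemma lat_scale_ge1 k : 1 <= lat_scale k.
Proof. by rewrite /lat_scale; case: ifP => _ //; exact: root4_ge1. Qed.

Definition lat_mx : 'M[R]_8 := diag_mx (\row_k lat_scale k).
(** The rows are a basis of $\mathbb Z[\sqrt 2]^8$ over the integers, under the two real
    embeddings of the coefficients.  The scaling of the first coordinate by the
    fourth root of two turns the form $\sqrt 2 x_0^2 - x_1^2 - \dots - x_7^2$ into the
    Lorentz form in the first embedding, and the opposite of its Galois conjugate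
    into the Euclidean form in the second one. *)
Definition emb1 : 'M[R]_(8 + 8, 8) := col_mx lat_mx (sqrt2 *: lat_mx).
Definition emb2 : 'M[R]_(8 + 8, 8) := col_mx lat_mx (- sqrt2 *: lat_mx).

Definition timeproj : 'M[int]_8 := delta_mx 0 0.
Definition spaceproj : 'M[int]_8 := 1%:M - timeproj.
(** The two integral components of the form with values in $\mathbb Z[\sqrt 2]$: the real
    Gram matrices are $\sqrt 2 Q + P$ and $\sqrt 2 Q - P$. *)
Definition gramP : 'M[int]_(8 + 8) := block_mx (- spaceproj) (2 *: timeproj) (2 *: timeproj) (- 2 *: spaceproj).
Definition gramQ : 'M[int]_(8 + 8) := block_mx timeproj (- spaceproj) (- spaceproj) (2 *: timeproj).

Definition gram1 : 'M[R]_(8 + 8) := emb1 *m J *m emb1^T.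
Definition gram2 : 'M[R]_(8 + 8) := emb2 *m emb2^T.

Lemma mul_emb1 (u w : 'rV[R]_8) k :
  (row_mx u w *m emb1) 0 k = (u 0 k + sqrt2 * w 0 k) * lat_scale k.
Proof.
have entry (a b : 'rV[R]_8) (c : R) : (a + c *: b) 0 k = a 0 k + c * b 0 k.
  by rewrite !mxE.
by rewrite mul_row_col -scalemxAr entry !mul_mx_diag !mxE mulrDl mulrA.
Qed.

Lemma mul_emb2 (u w : 'rV[R]_8) k :
  (row_mx u w *m emb2) 0 k = (u 0 k - sqrt2 * w 0 k) * lat_scale k.
Proof.
have entry (a b : 'rV[R]_8) (c : R) : (a + c *: b) 0 k = a 0 k + c * b 0 k.
  by rewrite !mxE.
by rewrite mul_row_col -scalemxAr entry !mul_mx_diag !mxE mulrDl mulrA mulNr.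
Qed.

Lemma scale_lorentz : lat_mx *m J *m lat_mx^T = sqrt2 *: intmx R timeproj - intmx R spaceproj.
Proof.
rewrite /lat_mx /lorentz tr_diag_mx !mulmx_diag.
apply/matrixP => i j; rewrite !mxE /lat_scale rmorphB /= !rmorph_nat.
have [->|ij] := eqVneq i j.
  by case: (j == 0); rewrite /= ?mulr1n ?mulr0n ?mul1r ?mulr1 -?expr2 ?root4_sq; ring.
have -> : (i == 0) && (j == 0) = false.
  by apply: contra_neqF ij => /andP[/eqP -> /eqP ->].
by rewrite !mulr0n /=; ring.
Qed.

Lemma scale_sq : lat_mx *m lat_mx^T = sqrt2 *: intmx R timeproj + intmx R spaceproj.
Proof.
rewrite /lat_mx tr_diag_mx mulmx_diag.
apply/matrixP => i j; rewrite !mxE /lat_scale rmorphB /= !rmorph_nat.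
have [->|ij] := eqVneq i j.
  by case: (j == 0); rewrite /= ?mulr1n ?mulr0n ?mul1r ?mulr1 -?expr2 ?root4_sq; ring.
have -> : (i == 0) && (j == 0) = false.
  by apply: contra_neqF ij => /andP[/eqP -> /eqP ->].
by rewrite !mulr0n /=; ring.
Qed.

Lemma intmxZ m n (a : int) (A : 'M[int]_(m, n)) :
  intmx R (a *: A) = a%:~R *: intmx R A.
Proof. exact: map_mxZ. Qed.

Lemma intmxN m n (A : 'M[int]_(m, n)) : intmx R (- A) = - intmx R A.
Proof. exact: map_mxN. Qed.

Lemma gram1E : gram1 = sqrt2 *: intmx R gramQ + intmx R gramP.
Proof.
rewrite /gram1 /emb1 mul_col_mx tr_col_mx mul_col_row -!scalemxAl !linearZ /=.
rewrite !scalerA -expr2 sqrt2_sq scale_lorentz.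
rewrite [intmx R gramQ]map_block_mx [intmx R gramP]map_block_mx.
rewrite -!/(intmx R _) !intmxZ !intmxN scale_block_mx add_block_mx.
congr block_mx.
- by rewrite scalerBr scalerA -expr2 sqrt2_sq addrC scalerN.
- by rewrite scalerBr scalerA -expr2 sqrt2_sq addrC scalerN.
- by rewrite scalerBr !scalerA mulrC rmorphN scaleNr.
Qed.

Lemma gram2E : gram2 = sqrt2 *: intmx R gramQ - intmx R gramP.
Proof.
rewrite /gram2 /emb2 tr_col_mx mul_col_row -!scalemxAl !linearZ /=.
rewrite !scalerA mulrNN -expr2 sqrt2_sq scale_sq.
rewrite [intmx R gramQ]map_block_mx [intmx R gramP]map_block_mx.
rewrite -!/(intmx R _) !intmxZ !intmxN scale_block_mx opp_block_mx add_block_mx.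
congr block_mx.
- by rewrite opprK.
- by rewrite scalerDr scalerA mulNr -expr2 sqrt2_sq addrC scalerN !scaleNr.
- by rewrite scalerDr scalerA mulNr -expr2 sqrt2_sq addrC scalerN !scaleNr.
- by rewrite scalerDr !scalerA mulrC rmorphN scaleNr opprK.
Qed.
Lemma qf_lin n (S T : 'M[R]_n) a (v : 'rV[R]_n) :
  qf (a *: S + T) v = a * qf S v + qf T v.
Proof.
have entry (p q : 'M[R]_1) : (a *: p + q) 0 0 = a * p 0 0 + q 0 0 by rewrite !mxE.
by rewrite /qf mulmxDr mulmxDl -scalemxAr -scalemxAl entry.
Qed.

Lemma qf_intmx n (S : 'M[int]_n) (v : 'rV[int]_n) :
  qf (intmx R S) (intmx R v) = (qf S v)%:~R.
Proof. by rewrite /qf /intmx -map_mxM map_trmx -map_mxM mxE. Qed.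

Lemma qf_gram1_int v : qf gram1 (intmx R v) = sqrt2 * (qf gramQ v)%:~R + (qf gramP v)%:~R.
Proof. by rewrite gram1E qf_lin !qf_intmx. Qed.

Lemma qf_gram2_int v : qf gram2 (intmx R v) = sqrt2 * (qf gramQ v)%:~R - (qf gramP v)%:~R.
Proof.
rewrite gram2E qf_lin !qf_intmx; congr (_ + _).
have entry (p : 'M[R]_1) : (- p) 0 0 = - p 0 0 by rewrite mxE.
by rewrite -(qf_intmx gramP) /qf mulmxN mulNmx entry.
Qed.

Lemma qf_gram m n (B : 'M[R]_(m, n)) (v : 'rV[R]_m) : qf (B *m B^T) v = \sum_k (v *m B) 0 k ^+ 2.
Proof.
rewrite /qf mulmxA -mulmxA -trmx_mul mxE; apply: eq_bigr => k _.
by rewrite [_^T _ _]mxE expr2.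
Qed.

Lemma qf_gram2_ge0 (v : 'rV[R]_(8 + 8)) : 0 <= qf gram2 v.
Proof. by rewrite qf_gram; apply: sumr_ge0 => k _; exact: sqr_ge0. Qed.

(** The two real forms are the images of one form over $\mathbb Z[\sqrt 2]$ under
    the two real embeddings (up to sign), so that their product is the norm
    $2 r^2 - p^2$ of a nonzero element. *)
Lemma anisotropic v : v != 0 ->
  1 <= `|qf gram1 (intmx R v)| + qf gram2 (intmx R v).
Proof.
move=> v0; have q2_ge0 := qf_gram2_ge0 (intmx R v).
set q1 := qf gram1 _; set q2 := qf gram2 _.
have qE : q1 * q2 = (2 * qf gramQ v ^+ 2 - qf gramP v ^+ 2)%:~R.
  rewrite /q1 /q2 qf_gram1_int qf_gram2_int intrB !expr2 !intrM.
  have -> : (2 : int)%:~R = sqrt2 ^+ 2 by rewrite sqrt2_sq.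
  by ring.
have [d0|dn0] := eqVneq (2 * qf gramQ v ^+ 2 - qf gramP v ^+ 2) 0; last first.
  have : 1 <= `|q1| * q2.
    rewrite -[q2]ger0_norm// -normrM qE norm_intr_ge1 ?intr_int//.
    by rewrite intr_eq0.
  have := normr_ge0 q1; have [q2b|q2s] := leP 1 q2; nra.
have pQ : qf gramP v ^+ 2 = 2 * qf gramQ v ^+ 2.
  by apply/eqP; rewrite eq_sym -subr_eq0 d0.
have Q0 := sqr_eq_double pQ.
have P0 : qf gramP v = 0 by apply/eqP; rewrite -sqrf_eq0 pQ Q0 expr0n mulr0.
case/eqP: v0.
have : q2 = 0 by rewrite /q2 qf_gram2_int Q0 P0 mulr0 subr0.
rewrite /q2 qf_gram => s0.
have coord k : (intmx R v *m emb2) 0 k = 0.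
  apply/eqP; rewrite -sqrf_eq0; apply/eqP.
  by apply: (psumr_eq0P _ s0) => // i _; exact: sqr_ge0.
pose u : 'rV[int]_8 := lsubmx v; pose w : 'rV[int]_8 := rsubmx v.
have vE : v = row_mx u w by rewrite hsubmxK.
have uw k : u 0 k = 0 /\ w 0 k = 0.
  apply: int_sqrt2_eq0; have := coord k.
  rewrite vE [intmx R _]map_row_mx mul_emb2 => /eqP; rewrite mulf_eq0 => /orP[|/eqP s].
    by rewrite !mxE subr_eq0 => /eqP.
  by have := lat_scale_ge1 k; rewrite s ler10.
have u0 : u = 0 by apply/rowP => k; have [-> _] := uw k; rewrite [RHS]mxE.
have w0 : w = 0 by apply/rowP => k; have [_ ->] := uw k; rewrite [RHS]mxE.
by rewrite vE u0 w0 row_mx0.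
Qed.

(** The positive definite form that $z$ induces on the lattice. *)
Definition latform z : 'M[R]_(8 + 8) := emb1 *m hyp z *m emb1^T + gram2.

Lemma qf_latform z (v : 'rV[R]_(8 + 8)) : qf (latform z) v = qf (hyp z) (v *m emb1) + qf gram2 v.
Proof.
have entry (p q : 'M[R]_1) : (p + q) 0 0 = p 0 0 + q 0 0 by rewrite !mxE.
by rewrite -qfM /latform {1}/qf mulmxDr mulmxDl entry.
Qed.

Lemma latform_ge1 z v : sqnorm z = 1 -> v != 0 -> 1 <= qf (latform z) (intmx R v).
Proof.
move=> z1 v0; rewrite qf_latform (le_trans (anisotropic v0))// lerD2r.
by rewrite /gram1 qfM hyp_ge.
Qed.

Lemma latform_tr z : (latform z)^T = latform z.
Proof.
by rewrite linearD /= !trmx_mul !trmxK hyp_tr mulmxA.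
Qed.

Definition emb : 'M[R]_(8 + 8) := row_mx emb1 emb2.

Lemma mulmx_emb0 (v : 'rV[R]_(8 + 8)) : v *m emb = 0 -> v = 0.
Proof.
rewrite mul_mx_row => /(congr1 (fun M : 'rV[R]_(8 + 8) => (lsubmx M, rsubmx M))).
rewrite row_mxKl row_mxKr !linear0 => -[e1 e2].
rewrite -[v]hsubmxK in e1 e2 *; move: (lsubmx v) (rsubmx v) e1 e2 => u w e1 e2.
have uw k : u 0 k = 0 /\ w 0 k = 0.
  have := congr1 (fun M : 'rV[R]_8 => M 0 k) e1.
  have := congr1 (fun M : 'rV[R]_8 => M 0 k) e2.
  rewrite mul_emb1 mul_emb2 !mxE; have := lat_scale_ge1 k; have := sqrt2_gt1 => a b.
  move=> /eqP; rewrite mulf_eq0 (_ : (lat_scale k == 0) = false) ?orbF; last first.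
    by rewrite gt_eqF// (lt_le_trans _ b).
  move=> /eqP c /eqP; rewrite mulf_eq0 (_ : (lat_scale k == 0) = false) ?orbF; last first.
    by rewrite gt_eqF// (lt_le_trans _ b).
  move=> /eqP d; have u0 : u 0 k = 0 by lra.
  split=> //; have : sqrt2 * w 0 k = 0 by lra.
  by move/eqP; rewrite mulf_eq0 => /orP[|] /eqP // r0; move: a; rewrite r0 ltr10.
have u0 : u = 0 by apply/rowP => k; have [-> _] := uw k; rewrite [RHS]mxE.
have w0 : w = 0 by apply/rowP => k; have [_ ->] := uw k; rewrite [RHS]mxE.
by rewrite u0 w0 row_mx0.
Qed.

Lemma emb_unit : emb \in unitmx.
Proof. by rewrite -row_free_unit; apply: inj_row_free => v; exact: mulmx_emb0. Qed.

Lemma latformE z : latform z = emb *m block_mx (hyp z) 0 0 1%:M *m emb^T.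
Proof.
rewrite /emb mul_row_block !mulmx0 addr0 add0r mulmx1 tr_row_mx mul_row_col.
by rewrite /latform /gram2.
Qed.

Lemma det_latform z : sqnorm z = 1 -> \det (latform z) <= \det emb ^+ 2.
Proof.
move=> z1; rewrite latformE !det_mulmx det_tr det_ublock det1 mulr1.
rewrite mulrAC -expr2 -[leRHS]mulr1 ler_wpM2l ?sqr_ge0//.
by rewrite (le_trans (ler_norm _))// det_hyp.
Qed.

(** Hermite reduction, uniformly in $z$: the determinant of the form is bounded
    and its values on the lattice are at least one, so the product bound becomes a
    bound for each basis vector. *)
Lemma reduced_basis : exists2 c : R, 1 <= c & forall z, sqnorm z = 1 ->
  exists2 U, U \in unitmx & forall i, qf (latform z) (intmx R (row i U)) <= c.
Proof.
have [K K0 red] := hermite_reduction R (8 + 8).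
exists (1 + K * \det emb ^+ 2); first by rewrite lerDl mulr_ge0 ?sqr_ge0// ltW.
move=> z z1.
have [U Uu Ule] := red (latform z) 1 (latform_tr z) ltr01 (fun v => latform_ge1 z1).
exists U => // i.
have rowU j : row j U != 0.
  apply/eqP => Uj0; have : (delta_mx 0 j : 'rV[int]_(8 + 8)) = 0.
    by rewrite -(mulmxK Uu (delta_mx 0 j)) -rowE Uj0 mul0mx.
  by move/rowP/(_ j)/eqP; rewrite !mxE !eqxx.
have ge1 j := latform_ge1 z1 (rowU j).
apply: (@le_trans _ _ (\prod_j qf (latform z) (intmx R (row j U)))).
  rewrite (bigD1 i)//= ler_peMr ?(le_trans ler01)//.
  by elim/big_ind: _ => // x y x1 y1; rewrite -[1]mulr1 ler_pM.
apply: (le_trans Ule); rewrite (@le_trans _ _ (K * \det emb ^+ 2)) ?lerDr//.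
by rewrite ler_pM2l// det_latform.
Qed.

Definition preserves_PQ N := N *m gramP *m N^T = gramP /\ N *m gramQ *m N^T = gramQ.

Lemma preserves_gram1 N : preserves_PQ N -> intmx R N *m gram1 *m (intmx R N)^T = gram1.
Proof.
move=> [NP NQ]; rewrite gram1E mulmxDr mulmxDl -scalemxAr -scalemxAl.
by rewrite [(intmx R N)^T]map_trmx -!map_mxM NP NQ.
Qed.

Lemma preserves_gram2 N : preserves_PQ N -> intmx R N *m gram2 *m (intmx R N)^T = gram2.
Proof.
move=> [NP NQ]; rewrite gram2E mulmxBr mulmxBl -scalemxAr -scalemxAl.
by rewrite [(intmx R N)^T]map_trmx -!map_mxM NP NQ.
Qed.

(** An isometry of both forms respects the decomposition of the ambient space into
    the two factors, as the second factor is the radical of the first form. *)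
Lemma lattice_isom_split N : preserves_PQ N -> exists2 A : 'M[R]_8,
  A *m J *m A^T = J & intmx R N *m emb1 = emb1 *m A.
Proof.
move=> /preserves_gram1 NS; pose M := invmx emb *m intmx R N *m emb.
have NT : intmx R N *m emb = emb *m M by rewrite /M !mulmxA mulmxV ?emb_unit// mul1mx.
pose a : 'M[R]_8 := ulsubmx M; pose b : 'M[R]_8 := ursubmx M.
pose c : 'M[R]_8 := dlsubmx M; pose d : 'M[R]_8 := drsubmx M.
have ME : M = block_mx a b c d by rewrite submxK.
pose J0 : 'M[R]_(8 + 8) := block_mx J 0 0 0.
have gram1T : gram1 = emb *m J0 *m emb^T.
  rewrite /emb mul_row_block !mulmx0 !addr0 tr_row_mx mul_row_col.
  by rewrite mul0mx addr0.
have MJ : M *m J0 *m M^T = J0.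
  apply: (can_inj (mulKmx emb_unit)); apply: (can_inj (mulmxK (_ : emb^T \in unitmx))).
    by rewrite unitmx_tr emb_unit.
  have : (intmx R N *m emb) *m J0 *m (intmx R N *m emb)^T = emb *m J0 *m emb^T.
    by rewrite trmx_mul -gram1T -NS gram1T !mulmxA.
  by rewrite NT trmx_mul !mulmxA.
move: MJ; rewrite ME /J0 mulmx_block tr_block_mx mulmx_block.
rewrite !mulmx0 !addr0 !mul0mx !addr0 => /eq_block_mx[aa ac _ _].
have au : a \in unitmx.
  by have [] := mulmx1_unit (_ : a *m (J *m a^T *m J) = 1%:M); rewrite // !mulmxA aa lorentz_sq.
have c0 : c = 0.
  have Ju : J \in unitmx by have [] := mulmx1_unit (lorentz_sq R).
  apply: trmx_inj; rewrite trmx0; apply: (can_inj (mulKmx Ju)).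
  by apply: (can_inj (mulKmx au)); rewrite mulmxA ac !mulmx0.
exists a => //; move: NT; rewrite ME /emb mul_mx_row mul_row_block.
by move=> /eq_row_mx[-> _]; rewrite c0 mulmx0 addr0.
Qed.

(** By polarisation. *)
Lemma entry_le_diag n (S M : 'M[R]_n) b i j : S^T = S -> M^T = M ->
    (forall v : 'rV[R]_n, `|qf S v| <= qf M v) -> (forall k, M k k <= b) ->
  `|S i j| <= b.
Proof.
move=> Ssym Msym SM Mb.
have diag (X : 'M[R]_n) k : qf X (delta_mx 0 k) = X k k.
  by rewrite /qf trmx_delta -rowE -colE !mxE.
have off : ((delta_mx 0 i : 'rV[R]_n) *m S *m (delta_mx 0 j : 'rV[R]_n)^T) 0 0 = S i j.
  by rewrite trmx_delta -rowE -colE !mxE.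
have := SM (delta_mx 0 i + delta_mx 0 j); have := SM (delta_mx 0 i - delta_mx 0 j).
rewrite (qfB_sym _ _ Ssym) (qfB_sym _ _ Msym) (qfD_sym _ _ Ssym) (qfD_sym _ _ Msym).
rewrite off !diag !ler_norml => /andP[h1 h2] /andP[h3 h4].
by have := Mb i; have := Mb j; lra.
Qed.

(** The positive form dominates both real forms, so that their Gram matrices in a short
    basis are bounded, and with them the integral components.  This leaves finitely
    many possibilities for the latter. *)
Lemma gram_bounded z U c i j : sqnorm z = 1 ->
    (forall k, qf (latform z) (intmx R (row k U)) <= c) ->
  `|((U *m gramP *m U^T) i j)%:~R : R| <= c /\ `|((U *m gramQ *m U^T) i j)%:~R : R| <= c.
Proof.
move=> z1 Uc; pose V := intmx R U.
have gramsym (S : 'M[R]_(8 + 8)) : S^T = S -> (V *m S *m V^T)^T = V *m S *m V^T.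
  by move=> Ssym; rewrite !trmx_mul trmxK Ssym mulmxA.
have diag k : (V *m latform z *m V^T) k k <= c.
  by rewrite -gram_entry -/(qf _ _) /V -map_row; exact: Uc.
have gram1sym : gram1^T = gram1 by rewrite !trmx_mul trmxK lorentz_tr mulmxA.
have gram2sym : gram2^T = gram2 by rewrite trmx_mul trmxK.
have q1 : `|(V *m gram1 *m V^T) i j| <= c.
  apply: (@entry_le_diag _ _ (V *m latform z *m V^T)) => //.
  - exact: gramsym.
  - exact/gramsym/latform_tr.
  - move=> x; rewrite !qfM qf_latform -[leLHS]addr0 lerD ?qf_gram2_ge0//.
    exact: hyp_ge.
have q2 : `|(V *m gram2 *m V^T) i j| <= c.
  apply: (@entry_le_diag _ _ (V *m latform z *m V^T)) => //.
  - exact: gramsym.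
  - exact/gramsym/latform_tr.
  - move=> x; rewrite !qfM qf_latform ger0_norm ?qf_gram2_ge0// lerDr.
    exact: le_trans (hyp_ge _ z1).
have PE : ((U *m gramP *m U^T) i j)%:~R = (V *m intmx R gramP *m V^T) i j.
  by rewrite /V /intmx -map_mxM [(map_mx _ U)^T]map_trmx -map_mxM [RHS]mxE.
have QE : ((U *m gramQ *m U^T) i j)%:~R = (V *m intmx R gramQ *m V^T) i j.
  by rewrite /V /intmx -map_mxM [(map_mx _ U)^T]map_trmx -map_mxM [RHS]mxE.
rewrite PE QE; move: q1 q2.
have entry (p q : 'M[R]_(8 + 8)) a : (a *: p + q) i j = a * p i j + q i j by rewrite !mxE.
have entryB (p q : 'M[R]_(8 + 8)) a : (a *: p - q) i j = a * p i j - q i j by rewrite !mxE.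
rewrite gram1E gram2E mulmxDr mulmxBr mulmxDl mulmxBl -!scalemxAr -!scalemxAl.
rewrite entry entryB; set p := (V *m _ *m _) i j; set q := (V *m _ *m _) i j.
have := sqrt2_gt1; rewrite !ler_norml => r21 /andP[h1 h2] /andP[h3 h4].
have : - c <= sqrt2 * q <= c by lra.
move=> /andP[h5 h6]; split; first lra.
have c0 : 0 <= c by lra.
by apply/andP; split; nra.
Qed.

Lemma int_coord_bounded (v : 'rV[R]_(8 + 8)) b : 
  (forall k, `|(v *m emb1) 0 k| <= b) -> (forall k, `|(v *m emb2) 0 k| <= b) ->
  forall j, `|v 0 j| <= b.
Proof.
rewrite -[v]hsubmxK; move: (lsubmx v) (rsubmx v) => u w h1 h2.
have uw k : `|u 0 k| <= b /\ `|w 0 k| <= b.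
  have := h1 k; have := h2 k; rewrite mul_emb1 mul_emb2 !normrM.
  have s1 := lat_scale_ge1 k; rewrite (ger0_norm (le_trans ler01 s1)).
  have shrink (x : R) : `|x| * lat_scale k <= b -> `|x| <= b.
    by apply: le_trans; rewrite ler_peMr.
  move=> /shrink + /shrink; rewrite !ler_norml => /andP[h3 h4] /andP[h5 h6].
  have r21 := sqrt2_gt1.
  have : - b <= sqrt2 * w 0 k <= b by lra.
  move=> /andP[h7 h8]; have b0 : 0 <= b by lra.
  split; first by lra.
  by apply/andP; split; nra.
by move=> j; case: (@split_ordP 8 8 j) => k ->; rewrite ?row_mxEl ?row_mxEr; case: (uw k).
Qed.

End Lattice.

(** * The arithmetic group *)

Lemma finite_int_matrices n (b : nat) :
  finite_set [set N : 'M[int]_n | forall i j, (`|N i j| <= b)%N].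
Proof.
pose f (M : 'M['I_(b + b).+1]_n) : 'M[int]_n := \matrix_(i, j) ((M i j)%:Z - b%:Z).
apply: (@sub_finite_set _ _ (f @` [set: 'M['I_(b + b).+1]_n])); last first.
  by apply: finite_image; exact: finite_finset.
move=> N /= Nb; exists (\matrix_(i, j) inord (absz (N i j + b%:Z)%R)) => //.
apply/matrixP => i j; rewrite !mxE inordK; have := Nb i j; lia.
Qed.

Lemma finite_reps (T F : Type) (f : T -> F) (A : set T) : finite_set (f @` A) ->
  exists B : set T, [/\ finite_set B, B `<=` A & forall x, A x -> exists2 y, B y & f y = f x].
Proof.
move=> fA; have [[x0 Ax0]|A0] := pselect (exists x, A x); last first.
  exists set0; split=> // x Ax; case: A0; by exists x.
have /choice[g gP] : forall w, exists y, (f @` A) w -> A y /\ f y = w.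
  move=> w; have [[y Ay yw]|nw] := pselect ((f @` A) w); first by exists y.
  by exists x0.
exists (g @` (f @` A)); split; first exact: finite_image.
  by move=> _ [w wA <-]; have [] := gP w wA.
move=> x Ax; have wA : (f @` A) (f x) by exists x.
by exists (g (f x)); [exists (f x) | have [] := gP _ wA].
Qed.

Lemma finite_bounded (R : realType) (T : Type) (B : set T) (beta : T -> R) :
  finite_set B -> exists M, forall x, B x -> beta x <= M.
Proof.
move=> fB; have /finite_seqP[s sE] : finite_set (beta @` B) by exact: finite_image.
exists (\sum_(y <- s) `|y|) => x Bx.
have : [set` s] (beta x) by rewrite -sE; exists x.
move=> /= xs; rewrite (big_rem _ xs) /= (le_trans (ler_norm _))// lerDl.
by apply: sumr_ge0.
Qed.

Section ArithmeticGroup.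
Variable R : realType.
Local Notation C := R[i].
Implicit Types (z : 'cV[C]_8) (g h : 'M[C]_8) (N U : 'M[int]_(8 + 8)).
Local Notation J := (lorentz R).
Local Notation emb1 := (emb1 R).
Local Notation emb2 := (emb2 R).

(** The integral isometries in the principal congruence subgroup of level $m$. *)
Definition unit_congr (m : nat) N :=
  [/\ N \in unitmx, preserves_PQ N & exists M, N = 1%:M + m%:Z *: M].

(** The elements of $Spin(1,7)$ that cover such an isometry, through the first embedding. *)
Definition arith_spin (m : nat) g := exists N A,
  [/\ unit_congr m N, A \in unitmx, intmx R N *m emb1 = emb1 *m A & lifts g A].

Lemma unit_congr1 m : unit_congr m 1%:M.
Proof.
split; first exact: unitmx1; first by split; rewrite trmx1 mulmx1 mul1mx.
by exists 0; rewrite scaler0 addr0.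
Qed.

Lemma unit_congrM m N1 N2 : unit_congr m N1 -> unit_congr m N2 -> unit_congr m (N1 *m N2).
Proof.
move=> [u1 [p1 q1] [M1 e1]] [u2 [p2 q2] [M2 e2]]; split.
- by rewrite unitmx_mul u1.
- have e X : N1 *m N2 *m X *m (N1 *m N2)^T = N1 *m (N2 *m X *m N2^T) *m N1^T.
    by rewrite trmx_mul !mulmxA.
  by split; rewrite e ?p2 ?q2.
- exists (M1 + M2 + m%:Z *: (M1 *m M2)); rewrite e1 e2 mulmxDl mul1mx mulmxDr mulmx1.
  rewrite -scalemxAl -scalemxAr !scalerDr -addrA; congr (_ + _).
  by rewrite addrCA addrA.
Qed.

Lemma unit_congrV m N : unit_congr m N -> unit_congr m (invmx N).
Proof.
move=> [u [p q] [M e]]; split; first by rewrite unitmx_inv.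
  have inv X : N *m X *m N^T = X -> invmx N *m X *m (invmx N)^T = X.
    move=> {1}<-; rewrite !mulmxA mulVmx// mul1mx -mulmxA -trmx_mul mulVmx//.
    by rewrite trmx1 mulmx1.
  by split; exact: inv.
exists (- (invmx N *m M)).
have : invmx N *m N = 1%:M by rewrite mulVmx.
rewrite {2}e mulmxDr mulmx1 -scalemxAr => /(canRL (addrK _)) h.
by rewrite scalerN.
Qed.

Lemma arith_spin1 m : arith_spin m 1%:M.
Proof.
exists 1%:M, 1%:M; split; rewrite ?unitmx1//; first exact: unit_congr1.
  by rewrite /intmx map_mx1 mulmx1 mul1mx.
exact: lifts1.
Qed.

Lemma arith_spinM m g h : arith_spin m g -> arith_spin m h -> arith_spin m (g *m h).
Proof.
move=> [N [A [uN uA NA gA]]] [N' [A' [uN' uA' NA' hA']]].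
exists (N' *m N), (A' *m A); split; first exact: unit_congrM; last exact: lifts_mul.
  by rewrite unitmx_mul uA'.
by rewrite /intmx map_mxM -!/(intmx R _) -mulmxA NA mulmxA NA' mulmxA.
Qed.

Lemma intmx_unit N : N \in unitmx -> intmx R N \in unitmx.
Proof. by rewrite !unitmxE det_map_mx; apply: rmorph_unit. Qed.

Lemma intmx_inv N : N \in unitmx -> intmx R (invmx N) = invmx (intmx R N).
Proof.
move=> Nu; apply: (can_inj (mulKmx (intmx_unit Nu))).
by rewrite mulmxV ?intmx_unit// -map_mxM mulmxV// map_mx1.
Qed.

Lemma arith_spinV m g : g^T *m g = 1%:M -> arith_spin m g -> arith_spin m g^T.
Proof.
move=> gg [N [A [uN uA NA gA]]]; exists (invmx N), (invmx A); split.
- exact: unit_congrV.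
- by rewrite unitmx_inv.
- have [Nu _ _] := uN; rewrite intmx_inv//.
  apply: (can_inj (mulKmx (intmx_unit Nu))).
  by rewrite mulmxA mulmxV ?intmx_unit// mul1mx mulmxA NA -mulmxA mulmxV// mulmx1.
- exact: lifts_inv.
Qed.

Lemma latform_ge0 z (v : 'rV[R]_(8 + 8)) : sqnorm z = 1 -> 0 <= qf (latform z) v.
Proof.
move=> z1; rewrite qf_latform addr_ge0 ?qf_gram2_ge0//.
exact: le_trans (hyp_ge _ z1).
Qed.

Lemma qf_latform_arith g N (A : 'M[R]_8) z (v : 'rV[R]_(8 + 8)) :
    g^T *m g = 1%:M -> lifts g A -> preserves_PQ N ->
    intmx R N *m emb1 = emb1 *m A ->
  qf (latform (g *m z)) (v *m intmx R N) = qf (latform z) v.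
Proof.
move=> gg gA Npq NA.
have e1 : v *m intmx R N *m emb1 = v *m emb1 *m A by rewrite -mulmxA NA mulmxA.
have e2 := qf_hyp_lifts (v *m emb1) z gg gA.
have e3 : qf (gram2 R) (v *m intmx R N) = qf (gram2 R) v by rewrite -qfM preserves_gram2.
transitivity (qf (hyp (g *m z)) (v *m emb1 *m A) + qf (gram2 R) v).
  by rewrite -e1 -e3; exact: qf_latform.
transitivity (qf (hyp z) (v *m emb1) + qf (gram2 R) v); last exact/esym/qf_latform.
exact: (congr1 (fun a => a + qf (gram2 R) v) e2).
Qed.

Lemma emb1_inj (A A' : 'M[R]_8) : emb1 *m A = emb1 *m A' -> A = A'.
Proof.
rewrite !mul_col_mx => /eq_col_mx[+ _] => /matrixP e; apply/matrixP => i j.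
have := e i j; rewrite /lat_mx !mul_diag_mx !mxE => /mulfI; apply.
by rewrite gt_eqF// (lt_le_trans ltr01)// lat_scale_ge1.
Qed.

(** An element with a fixed point is an isometry of the form attached to that
    point; being congruent to the identity modulo a large $m$, it moves each
    short basis vector by $m$ times a lattice vector of length less than one. *)
Lemma arith_spin_free : exists2 m : nat, (0 < m)%N & forall g z,
  special_orth g -> arith_spin m g -> sqnorm z = 1 -> g *m z = z -> g = 1%:M.
Proof.
have [c c1 red] := reduced_basis R.
pose m := (Num.truncn (4 * c)).+1.
exists m => // g z [gg _] [N [A [[Nu Npq [M NM]] Au NA gA]]] z1 gz.
have mc : 4 * c < m%:R by exact: truncnS_gt.
have [U Uu Uc] := red z z1.
have M0 : M = 0.
  apply: (can_inj (mulKmx Uu)); rewrite mulmx0; apply/row_matrixP => i; rewrite row0 row_mul.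
  apply/eqP; apply: contraT => w0; have := latform_ge1 z1 w0; have := Uc i.
  set v := intmx R (row i U); set w := intmx R (row i U *m M).
  have vN : v *m intmx R N = v + m%:R *: w.
    rewrite /v /w /intmx -map_mxM NM mulmxDr mulmx1 -scalemxAr map_mxD map_mxZ /=.
    by [].
  have qvN : qf (latform z) (v *m intmx R N) = qf (latform z) v.
    by have := qf_latform_arith z v gg gA Npq NA; rewrite gz.
  have := latform_ge0 (v *m intmx R N + v) z1.
  have := qfD_sym (v *m intmx R N) v (latform_tr z).
  have := qfB_sym (v *m intmx R N) v (latform_tr z).
  rewrite qvN {1}vN addrAC subrr add0r qfZ => e1 -> h1 h2 h3.
  suff : 1 < 1 :> R by rewrite ltxx.
  have m1 : 1 <= m%:R :> R by rewrite ler1n.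
  have : m%:R ^+ 2 * qf (latform z) w <= 4 * c by rewrite e1; lra.
  by nra.
have N1 : N = 1%:M by rewrite NM M0 scaler0 addr0.
have A1 : A = 1%:M.
  by apply: emb1_inj; rewrite -NA N1 /intmx map_mx1 mul1mx mulmx1.
rewrite A1 in gA; case: (lifts_id gg gA) => // gN.
have : z = 0.
  apply/colP => k; have := congr1 (fun u : 'cV[C]_8 => u k 0) gz.
  rewrite gN mulNmx mul1mx !mxE => /eqP; rewrite eq_sym -addr_eq0 -mulr2n mulrn_eq0 /=.
  by move/eqP.
move=> z0; move: z1; rewrite z0 /sqnorm big1 => [/esym/eqP|k _].
  by rewrite oner_eq0.
by rewrite mxE expr0n.
Qed.

Lemma qf_hyp_le z (y : 'rV[R]_8) : sqnorm z = 1 ->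
  qf (hyp z) y <= (\sum_k y 0 k ^+ 2) * (4 * hnorm z ^+ 2 + 1).
Proof.
move=> z1; rewrite qf_hyp; set s := \sum_k _.
have s0 : 0 <= s by apply: sumr_ge0 => k _; exact: sqr_ge0.
have cs : (y *m psi z) 0 0 ^+ 2 <= s * (2 * hnorm z ^+ 2).
  rewrite mxE (le_trans (cauchy_schwarz _ (fun k => y 0 k) (fun k => psi z k 0)))//.
  rewrite ler_wpM2l// (bigD1 0)//= -psi0.
  by have := psi_hyperboloid z1; lra.
have : - s <= qf J y.
  rewrite qf_lorentz_split /s (bigD1 0)//=; have := sqr_ge0 (y 0 0); lra.
by nra.
Qed.

(** Properness: a bound on $z$ and $gz$ bounds the images of the standard lattice
    vectors in the first factor; in the second one the form is definite and
    preserved. *)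
Lemma arith_spin_bounded (c : R) : exists b : nat, forall m g N (A : 'M[R]_8) z,
    special_orth g -> unit_congr m N -> intmx R N *m emb1 = emb1 *m A -> lifts g A ->
    sqnorm z = 1 -> hnorm z <= c -> hnorm (g *m z) <= c ->
  forall i j, (`|N i j| <= b)%N.
Proof.
pose s1 := \sum_i \sum_k (emb1 i k) ^+ 2 : R; pose s2 := \sum_i `|gram2 R i i|.
pose b := s1 * (4 * c ^+ 2 + 1) + (2 * c ^+ 2 + 1) + s2 + 1.
exists (Num.truncn b).+1 => m g N A z [gg _] [_ Npq _] NA gA z1 zc gzc i j.
have gz1 : sqnorm (g *m z) = 1 by rewrite sqnorm_orth.
have c2 (w : 'cV[C]_8) : sqnorm w = 1 -> hnorm w <= c -> hnorm w ^+ 2 <= c ^+ 2.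
  move=> w1 wc; rewrite lerXn2r ?nnegrE ?(le_trans ler01)//; first exact: hnorm_ge1.
  exact: le_trans (hnorm_ge1 w1) wc.
have s10 : 0 <= s1 by do 2![apply: sumr_ge0 => ? _]; exact: sqr_ge0.
have s20 : 0 <= s2 by apply: sumr_ge0.
have cc := sqr_ge0 c.
have s1c : 0 <= s1 * (4 * c ^+ 2 + 1) by rewrite mulr_ge0//; lra.
have part1 k : `|(row i (intmx R N) *m emb1) 0 k| <= b.
  have e : row i (intmx R N) *m emb1 = row i emb1 *m A by rewrite -!row_mul NA.
  rewrite e; have := hyp_coord (row i emb1 *m A) k gz1.
  have -> := qf_hyp_lifts (row i emb1) z gg gA.
  have := hyp_diag k gz1; have := c2 _ gz1 gzc.
  have := qf_hyp_le (row i emb1) z1.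
  have : (\sum_k row i emb1 0 k ^+ 2) * (4 * hnorm z ^+ 2 + 1) <= s1 * (4 * c ^+ 2 + 1).
    rewrite ler_pM ?sumr_ge0//.
    - by move=> l _; exact: sqr_ge0.
    - by have := sqr_ge0 (hnorm z); lra.
    - rewrite /s1 (bigD1 i)//=; under eq_bigr do rewrite mxE.
      by rewrite lerDl; do 2![apply: sumr_ge0 => ? _]; exact: sqr_ge0.
    - by have := c2 _ z1 zc; lra.
  rewrite /b; set a := `|_|; have : 0 <= a by exact: normr_ge0.
  lra.
have part2 k : `|(row i (intmx R N) *m emb2) 0 k| <= b.
  have e : qf (gram2 R) (row i (intmx R N)) = gram2 R i i.
    by rewrite -{2}(preserves_gram2 R Npq) -gram_entry.
  have : qf (gram2 R) (row i (intmx R N)) <= s2.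
    rewrite e (le_trans (ler_norm _))// /s2 (bigD1 i)//= lerDl.
    by apply: sumr_ge0.
  rewrite qf_gram (bigD1 k)//=; set x := (_ *m _) 0 k.
  have : 0 <= \sum_(l | l != k) (row i (intmx R N) *m emb2) 0 l ^+ 2.
    by apply: sumr_ge0 => l _; exact: sqr_ge0.
  move=> h1 h2; have : x ^+ 2 <= s2 by lra.
  move=> h3; have : 0 <= (`|x| - 1) ^+ 2 by exact: sqr_ge0.
  rewrite sqrrB1 real_normK ?num_real// => h4.
  have := sqr_ge0 x; rewrite /b; lra.
have := int_coord_bounded part1 part2 j; rewrite !mxE => h.
have : (absz (N i j))%:R < (Num.truncn b).+1%:R :> R.
  apply: le_lt_trans (truncnS_gt b); apply: le_trans h.
  by rewrite -intr_norm -abszE.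
by rewrite ltr_nat => /ltnW.
Qed.

Lemma arith_spin_finite (m : nat) (c : R) : finite_set
  [set g : 'M[C]_8 | [/\ special_orth g, arith_spin m g &
    exists z, [/\ sqnorm z = 1, hnorm z <= c & hnorm (g *m z) <= c]]].
Proof.
have [b bP] := arith_spin_bounded c.
set S := [set g | _].
have /choice[f fP] : forall g, exists N, S g -> (forall i j, (`|N i j| <= b)%N) /\
    exists2 A, A \in unitmx & intmx R N *m emb1 = emb1 *m A /\ lifts g A.
  move=> g; have [Sg|nSg] := pselect (S g); last by exists 0.
  have [go [N [A [uN Au NA gA]]] [z [z1 zc gzc]]] := Sg; exists N => _.
  by split; [exact: (bP _ _ _ _ _ go uN NA gA z1 zc gzc) | exists A].
have /finite_reps[B [Bfin BS BP]] : finite_set (f @` S).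
  apply: (sub_finite_set _ (@finite_int_matrices (8 + 8) b)).
  by move=> _ [g Sg <-] /=; have [] := fP g Sg.
apply: (@sub_finite_set _ _ (B `|` (fun g => - g) @` B)); last first.
  by rewrite finite_setU; split=> //; exact: finite_image.
move=> g Sg; have [h Bh hg] := BP g Sg.
have [_ [A Au [NA gA]]] := fP g Sg; have [_ [A' _ [NA' hA']]] := fP h (BS h Bh).
have AA : A' = A by apply: emb1_inj; rewrite -NA -NA' hg.
have [[gg _] _ _] := Sg; have [[hh _] _ _] := BS h Bh.
rewrite AA in hA'.
by case: (lifts_uniq hh gg Au hA' gA) => ->; [left | right; exists h].
Qed.

Lemma same_gram_preserves U V : U \in unitmx ->
  U *m (gramP) *m U^T = V *m gramP *m V^T -> U *m gramQ *m U^T = V *m gramQ *m V^T ->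
  preserves_PQ (invmx U *m V).
Proof.
move=> Uu; have e X : U *m X *m U^T = V *m X *m V^T ->
    invmx U *m V *m X *m (invmx U *m V)^T = X.
  move=> UV; rewrite trmx_mul !mulmxA -2!(mulmxA (invmx U)) -UV.
  by rewrite !mulmxA mulVmx// mul1mx -mulmxA -trmx_mul mulVmx// trmx1 mulmx1.
by move=> h1 h2; split; exact: e.
Qed.

Definition residue (m : nat) (U : 'M[int]_(8 + 8)) : 'M[int]_(8 + 8) :=
  map_mx (fun a => (a %% m%:Z)%Z) U.

Lemma residue_congr m U V : U \in unitmx -> residue m U = residue m V ->
  exists M, invmx U *m V = 1%:M + m%:Z *: M.
Proof.
move=> Uu /matrixP UV.
exists (invmx U *m \matrix_(i, j) ((V i j %/ m%:Z)%Z - (U i j %/ m%:Z)%Z)).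
rewrite scalemxAr -(mulVmx Uu) -mulmxDr; congr (_ *m _).
apply/matrixP => i j; have := UV i j; rewrite !mxE => e.
by rewrite {1}(divz_eq (V i j) m) {1}(divz_eq (U i j) m) e; ring.
Qed.

(** Up to the factor $2^{1/4}$, $|z|^2$ is the value of the covector of $z$ at a fixed
    lattice vector.  The latter is an integral combination of the basis, and at a
    basis vector of bounded length the covector has a bounded value. *)
Lemma hnorm_le_basis (c : R) V z : 1 <= c -> V \in unitmx -> sqnorm z = 1 ->
  (forall i, qf (hyp z) (row i (intmx R V) *m emb1) <= c) ->
  hnorm z <= c * \sum_i `|(invmx V (lshift 8 0) i)%:~R|.
Proof.
move=> c1 Vu z1 Vc.
have lin i : `|(row i (intmx R V) *m emb1 *m psi z) 0 0| <= c.
  have := Vc i; have := hyp_ge (row i (intmx R V) *m emb1) z1.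
  rewrite qf_hyp ler_norml; set t := (_ *m psi z) 0 0; set n := qf _ _.
  move=> /andP[h1 h2] h3; have t2 : t ^+ 2 <= c by lra.
  have : `|t| ^+ 2 <= c ^+ 2.
    rewrite real_normK ?num_real// (le_trans t2)// expr2 ler_peMr//.
    exact: le_trans c1.
  by rewrite ler_sqr// nnegrE// (le_trans ler01).
have row0 : row (lshift 8 0) emb1 = root4 R *: delta_mx 0 0.
  rewrite /emb1 rowKu; apply/rowP => k; rewrite !mxE /lat_scale !eqxx (eq_sym k).
  by case: (0 == k); rewrite ?mulr1 ?mulr1n ?mulr0 ?mulr0n.
have e : root4 R * hnorm z = \sum_i (invmx V (lshift 8 0) i)%:~R *
    (row i (intmx R V) *m emb1 *m psi z) 0 0.
  transitivity ((row (lshift 8 0) emb1 *m psi z) 0 0).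
    by rewrite row0 -scalemxAl -rowE [RHS]mxE [X in _ = _ * X]mxE psi0.
  have -> : row (lshift 8 0) emb1 = \sum_i (invmx V (lshift 8 0) i)%:~R *:
      (row i (intmx R V) *m emb1).
    rewrite -{1}[emb1]mul1mx -(mulVmx (intmx_unit Vu)) -intmx_inv// -mulmxA row_mul.
    rewrite mulmx_sum_row; apply: eq_bigr => i _; rewrite row_mul.
    by congr (_ *: _); rewrite !mxE.
  rewrite mulmx_suml summxE; apply: eq_bigr => i _.
  by rewrite -scalemxAl mxE.
have h0 : 0 <= hnorm z by exact: le_trans ler01 (hnorm_ge1 z1).
apply: (@le_trans _ _ (root4 R * hnorm z)); first by rewrite ler_peMl// root4_ge1.
rewrite e mulr_sumr ler_sum// => i _.
by rewrite (le_trans (ler_norm _))// normrM mulrC ler_wpM2r.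
Qed.

Definition short_basis (c : R) : set 'M[int]_(8 + 8) := [set U | U \in unitmx /\
  exists2 z, sqnorm z = 1 & forall i, qf (latform z) (intmx R (row i U)) <= c].

Lemma invariants_finite (m : nat) (c : R) : (0 < m)%N -> finite_set
  ((fun U => (U *m gramP *m U^T, U *m gramQ *m U^T, residue m U)) @` short_basis c).
Proof.
move=> m0; pose S := [set N : 'M[int]_(8 + 8) |
  forall i j, (`|N i j| <= (Num.truncn c).+1 + m)%N].
have fS : finite_set S by exact: finite_int_matrices.
apply: (sub_finite_set _ (finite_setX (finite_setX fS fS) fS)).
move=> _ [U [Uu [z z1 Uc]] <-] /=; split; first split.
- move=> i j; have [h _] := gram_bounded i j z1 Uc.
  have : (absz ((U *m gramP *m U^T) i j))%:R < (Num.truncn c).+1%:R :> R.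
    by apply: le_lt_trans (truncnS_gt c); rewrite -intr_norm in h; rewrite natr_absz.
  by rewrite ltr_nat => /ltnW/leq_trans; apply; exact: leq_addr.
- move=> i j; have [_ h] := gram_bounded i j z1 Uc.
  have : (absz ((U *m gramQ *m U^T) i j))%:R < (Num.truncn c).+1%:R :> R.
    by apply: le_lt_trans (truncnS_gt c); rewrite -intr_norm in h; rewrite natr_absz.
  by rewrite ltr_nat => /ltnW/leq_trans; apply; exact: leq_addr.
- move=> i j; rewrite mxE; have m0' : m%:Z != 0 by rewrite eqz_nat -lt0n.
  have := modz_ge0 (U i j) m0'; have := ltz_mod (U i j) m0'.
  by lia.
Qed.

(** Let $U$ be a short basis for $z$.  If $V$ is a short basis for some other point, with
    the same Gram matrices and the same residues, then $V^{-1} U$ is an integral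
    isometry congruent to $1$; its inverse moves $z$ to a point for which $V$ is short,
    and such points form a bounded set.  As there are finitely many Gram matrices and
    residues, finitely many $V$ suffice.  To make the isometry liftable, each class is
    subdivided according to the kind of the isometry that compares $U$ with one fixed
    basis of the class. *)
Lemma arith_spin_cocompact (m : nat) : (0 < m)%N -> exists c : R, forall z,
  sqnorm z = 1 -> exists g,
    [/\ special_orth g, arith_spin m g & hnorm (g *m z) <= c].
Proof.
move=> m0; have [c c1 red] := reduced_basis R.
pose inv (U : 'M[int]_(8 + 8)) := (U *m gramP *m U^T, U *m gramQ *m U^T, residue m U).
have [B0 [B0fin B0S B0P]] := finite_reps (invariants_finite c m0).
have /choice[r rP] : forall U, exists V, short_basis c U -> B0 V /\ inv V = inv U.
  move=> U; have [SU|nSU] := pselect (short_basis c U); last by exists 0.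
  by have [V BV VU] := B0P U SU; exists V.
have /choice[k kP] : forall U, exists k : 'M[R]_8 * (bool * bool), short_basis c U ->
    [/\ k.1 *m J *m k.1^T = J, intmx R (invmx (r U) *m U) *m emb1 = emb1 *m k.1 &
      spin_kind k.2.2 ((-1) ^+ k.2.1 *: k.1)].
  move=> U; have [SU|nSU] := pselect (short_basis c U); last by exists (0, (true, true)).
  have [BrU [eP eQ _]] := rP U SU; have [rUu _] := B0S _ BrU.
  have [A AJ NA] := lattice_isom_split R (same_gram_preserves rUu eP eQ).
  have [fl [odd Akind]] := lorentz_spin_kind AJ.
  by exists (A, (fl, odd)).
have [|B [Bfin BS BP]] := @finite_reps _ _ (fun U => (r U, (k U).2)) (short_basis c).
  apply: (@sub_finite_set _ _ (B0 `*` [set: bool * bool])); last first.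
    by apply: finite_setX => //; exact: finite_finset.
  by move=> _ [U SU <-] /=; split=> //; have [] := rP U SU.
have [M MP] := finite_bounded
  (fun V => c * \sum_i `|(invmx V (lshift 8 0) i)%:~R|) Bfin.
exists M => z z1; have [U Uu Uc] := red z z1.
have SU : short_basis c U by split=> //; exists z.
have [V BV VU] := BP U SU; have SV := BS V BV.
have rVU : r V = r U by have := congr1 fst VU.
have kVU : (k V).2 = (k U).2 by have := congr1 snd VU.
have [Vu _] := SV; have [BrU rUinv] := rP U SU; have [_ rVinv] := rP V SV.
have [rUu _] := B0S _ BrU.
have [eP eQ eres] : inv V = inv U by rewrite -rVinv -rUinv rVU.
have [AJ NA Akind] := kP U SU; have [AJ' NA' Akind'] := kP V SV.
set A := (k U).1 in AJ NA Akind; set A' := (k V).1 in AJ' NA' Akind'.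
have Au' : A' \in unitmx.
  have [] // := mulmx1_unit (_ : A' *m (J *m A'^T *m J) = 1%:M).
  by rewrite !mulmxA AJ' lorentz_sq.
have Au : A \in unitmx.
  have [] // := mulmx1_unit (_ : A *m (J *m A^T *m J) = 1%:M).
  by rewrite !mulmxA AJ lorentz_sq.
have sgn0 : (-1) ^+ (k V).2.1 != 0 :> R by rewrite signr_eq0.
rewrite -kVU in Akind.
have [g gso gl] := spin_kind_ratio sgn0 Au' Akind' Akind.
have gg := gso.1.
pose N := invmx V *m U.
have uN : unit_congr m N.
  split; first by rewrite unitmx_mul unitmx_inv Vu.
    exact: same_gram_preserves.
  exact: residue_congr.
have NB : intmx R N *m emb1 = emb1 *m (invmx A' *m A).
  rewrite rVU in NA'.
  have N1u : invmx (r U) *m V \in unitmx by rewrite unitmx_mul unitmx_inv rUu.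
  apply: (can_inj (mulKmx (intmx_unit N1u))).
  have VN : invmx (r U) *m V *m N = invmx (r U) *m U.
    by rewrite /N mulmxA -(mulmxA _ V) mulmxV// mulmx1.
  rewrite mulmxA -map_mxM VN -/(intmx R _) NA mulmxA NA' -mulmxA (mulmxA A').
  by rewrite mulmxV// mul1mx.
have ag : arith_spin m g.
  by exists N, (invmx A' *m A); split=> //; rewrite unitmx_mul unitmx_inv Au'.
exists g^T; split.
- by split; [rewrite trmxK mulmx1C | rewrite det_tr; case: gso].
- exact: arith_spinV.
apply: le_trans (MP V BV); set w := g^T *m z.
have gw : g *m w = z by rewrite /w mulmxA (mulmx1C gg) mul1mx.
have w1 : sqnorm w = 1 by rewrite -(sqnorm_orth _ gg) gw.
apply: hnorm_le_basis => // i.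
have <- := qf_hyp_lifts (row i (intmx R V) *m emb1) w gg gl.
rewrite gw.
have -> : row i (intmx R V) *m emb1 *m (invmx A' *m A) = intmx R (row i U) *m emb1.
  rewrite -mulmxA -NB mulmxA -row_mul -map_mxM /N mulmxA mulmxV// mul1mx.
  by rewrite /intmx map_row.
by apply: le_trans (Uc i); rewrite qf_latform lerDl qf_gram2_ge0.
Qed.

End ArithmeticGroup.

(** * The action on the complex sphere *)

Lemma near_dist_lt (K : numFieldType) (x e : K) : 0 < e ->
  \forall y \near x, `|x - y| < e.
Proof.
move=> e0; have /cvgrPdist_lt/(_ e e0) : (fun y : K => y) @ x --> x by exact: cvg_id.
by [].
Qed.

Lemma continuousPdist (K L : numFieldType) (f : K -> L) :
  (forall (x : K) (e : L), 0 < e -> exists2 d : K, 0 < d &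
    forall y, `|x - y| < d -> `|f x - f y| < e) -> continuous f.
Proof.
move=> fP x.
apply/(@cvgrPdist_lt L L _ (nbhs x) (nbhs_filter x) f (f x)) => e /(fP x)[d d0 fd].
near=> y; apply: fd; near: y; exact: near_dist_lt.
Unshelve. all: by end_near.
Qed.

Section PointwiseContinuity.
Variables (T : topologicalType) (K : numFieldType).
Implicit Types f g : T -> K.

Lemma continuous_fctD f g :
  continuous f -> continuous g -> continuous (fun x => f x + g x).
Proof. by move=> cf cg x; apply: cvgD; [exact: cf | exact: cg]. Qed.

Lemma continuous_fctM f g :
  continuous f -> continuous g -> continuous (fun x => f x * g x).
Proof. by move=> cf cg x; apply: cvgM; [exact: cf | exact: cg]. Qed.

Lemma continuous_fctN f : continuous f -> continuous (fun x => - f x).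
Proof. by move=> cf x; apply: cvgN; exact: cf. Qed.

Lemma continuous_fct_sum n (F : 'I_n -> T -> K) :
  (forall i, continuous (F i)) -> continuous (fun x => \sum_i F i x).
Proof.
move=> cF x; apply: (@cvg_big _ _ _ _ _ add_continuous) => i _; exact: cF.
Qed.

End PointwiseContinuity.

Section Topology.
Variable R : realType.
Local Notation C := R[i].
Local Notation CT := (R[i] : numFieldType).
Local Notation toC := (real_complex R).
Local Notation G := (SO C 8).

Lemma Re_continuous : continuous (fun x : CT => complex.Re x : R).
Proof.
apply: (@continuousPdist (R[i] : numFieldType) R) => x e e0.
exists (toC e); rewrite ?ltcR// => y; rewrite -[in X in _ -> X]ltcR.
by apply: le_lt_trans; rewrite -raddfB; exact: normc_ge_Re.
Qed.

Lemma toC_continuous : continuous (fun x : R => toC x : CT).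
Proof.
apply: (@continuousPdist R (R[i] : numFieldType)) => x e e0.
have eE : e = toC (complex.Re e) by rewrite RRe_real// gtr0_real.
exists (complex.Re e) => [|y]; first by rewrite -ltcR -eE.
rewrite eE -ltcR; apply: le_lt_trans.
rewrite -rmorphB normc_def /= expr0n addr0 sqrtr_sqr; exact: lexx.
Qed.

Lemma Im_continuous : continuous (fun x : CT => complex.Im x : R).
Proof.
apply: (@continuousPdist (R[i] : numFieldType) R) => x e e0.
exists (toC e); rewrite ?ltcR// => y; rewrite -[in X in _ -> X]ltcR.
apply: le_lt_trans; rewrite -raddfB.
have -> : `|x - y| = `|(x - y) * 'i%C|.
  by rewrite normrM (normc_def 'i%C) /= expr0n add0r expr1n sqrtr1 mulr1.
by rewrite -normrN -(ReiNIm (x - y)); exact: normc_ge_Re.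
Qed.

Definition base : 'cV[C]_8 := delta_mx 0 0.

Lemma sqnorm_base : sqnorm base = 1.
Proof. by rewrite sqnormE trmx_delta mul_delta_mx mxE. Qed.

Lemma hnorm_base : hnorm base = 1.
Proof.
rewrite /hnorm (bigD1 0)//= big1 ?mxE//= => [|k /negbTE k0].
  by rewrite expr1n expr0n !addr0.
by rewrite !mxE k0 /= expr0n addr0.
Qed.

Lemma sqnorm_SO (g : G) (z : 'cV[C]_8) : sqnorm (val g *m z) = sqnorm z.
Proof.
by apply: sqnorm_orth; exact: SO_trmxl.
Qed.

Lemma SO_special_orth (g : G) : special_orth (val g).
Proof. by split; [exact: SO_trmxl | exact: SO_det]. Qed.

Definition orbit_norm (g : G) : R := hnorm (val g *m base).

Lemma continuous_hnorm (T : topologicalType) (f : T -> 'cV[C]_8) :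
  (forall k, continuous (fun x => f x k 0 : CT)) -> continuous (fun x => hnorm (f x)).
Proof.
move=> cf; have cRe k : continuous (fun x => complex.Re (f x k 0) : R).
  move=> x; apply: (continuous_comp (f := fun x => f x k 0 : CT)
    (g := fun c : CT => complex.Re c : R)); [exact: cf | exact: Re_continuous].
have cIm k : continuous (fun x => complex.Im (f x k 0) : R).
  move=> x; apply: (continuous_comp (f := fun x => f x k 0 : CT)
    (g := fun c : CT => complex.Im c : R)); [exact: cf | exact: Im_continuous].
rewrite (_ : (fun _ => _) = fun x => \sum_k (complex.Re (f x k 0) *
  complex.Re (f x k 0) + complex.Im (f x k 0) * complex.Im (f x k 0))); last first.
  by apply/funext => x; apply: eq_bigr => k _; rewrite !expr2.
move=> x; apply: (@cvg_big _ _ _ _ _ add_continuous) => k _.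
by apply: cvgD; apply: cvgM; first [exact: cRe | exact: cIm].
Qed.

Lemma orbit_norm_continuous : continuous orbit_norm.
Proof.
apply: continuous_hnorm => k.
rewrite (_ : (fun _ => _) = fun g : G => val g k 0); first exact: SO_coord_continuous.
by apply/funext => g; rewrite -colE mxE.
Qed.

Lemma SO_standard_base (h : G) : h \in SO_standard C 7 -> val h *m base = base.
Proof.
move=> /SO_standardP[A hA]; rewrite hA /base -colE; apply/colP => k.
rewrite [LHS]mxE [RHS]mxE.
have <- : lshift 7 (0 : 'I_1) = 0 by exact: val_inj.
case: (@split_ordP 1 7 k) => j ->.
  by rewrite [LHS](@block_mxEul _ 1 7 1 7) mxE ord1 !eqxx.
by rewrite [LHS](@block_mxEdl _ 1 7 1 7) mxE -val_eqE.
Qed.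

Lemma base_SO_standard (g : G) : val g *m base = base -> g \in SO_standard C 7.
Proof.
move=> gb; have gTb : (val g)^T *m base = base by rewrite -{1}gb mulmxA SO_trmxl mul1mx.
have e0 : lshift 7 (0 : 'I_1) = 0 by exact: val_inj.
have gcol k : val g k 0 = (k == 0)%:R.
  by have /colP/(_ k) := gb; rewrite /base -colE !mxE andbT.
have grow k : val g 0 k = (k == 0)%:R.
  by have /colP/(_ k) := gTb; rewrite /base -colE !mxE andbT.
pose B := @drsubmx C 1 7 1 7 (val g).
have gB : val g = lift0_mx B.
  apply/matrixP => i j; case: (@split_ordP 1 7 i) => k ->;
    case: (@split_ordP 1 7 j) => l ->.
  - by rewrite [RHS](@block_mxEul _ 1 7 1 7) [RHS]mxE (ord1 k) (ord1 l) e0 gcol.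
  - by rewrite [RHS](@block_mxEur _ 1 7 1 7) [RHS]mxE (ord1 k) e0 grow -val_eqE.
  - by rewrite [RHS](@block_mxEdl _ 1 7 1 7) [RHS]mxE (ord1 l) e0 gcol -val_eqE.
  - by rewrite [RHS](@block_mxEdr _ 1 7 1 7) !mxE.
have BSO : B \in @special_orthogonal C 7.
  have := SO_trmxl g; have := SO_det g.
  rewrite gB (@det_ublock _ 1 7) det1 mul1r => B1.
  rewrite (@tr_block_mx _ 1 7 1 7) (@mulmx_block _ 1 7 1 7 1 7) !trmx0 trmx1.
  rewrite !(mulmx0, mul0mx, mulmx1) !(addr0, add0r) (@scalar_mx_block _ 1 7).
  by move=> /(@eq_block_mx _ 1 7 1 7)[_ _ _ BB]; rewrite inE BB B1 !eqxx.
by apply/SO_standardP; exists (Sub B BSO).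
Qed.

Definition stab : groupClosed G := SO_standard C 7.

Lemma pi_eqP (x y : G) :
  \pi_(homogeneous_space stab) x = \pi_(homogeneous_space stab) y <->
  val x *m base = val y *m base.
Proof.
split=> [/homogeneous_space_piP/SO_standard_base|xy].
  rewrite -[val (x^-1 * y)%g]/((val x)^T *m val y) => e.
  by rewrite -{1}e !mulmxA SO_trmxr mul1mx.
apply/homogeneous_space_piP/base_SO_standard.
by rewrite -[val (x^-1 * y)%g]/((val x)^T *m val y) -mulmxA -xy mulmxA SO_trmxl mul1mx.
Qed.

Definition cvec (v : 'rV[R]_(8 + 8)) : 'cV[C]_8 :=
  \col_k Complex (v 0 (lshift 8 k)) (v 0 (rshift 8 k)).

Lemma cvec_surj (z : 'cV[C]_8) : exists v, cvec v = z.
Proof.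
exists (row_mx (\row_k complex.Re (z k 0)) (\row_k complex.Im (z k 0))).
apply/colP => k; rewrite mxE row_mxEl row_mxEr !mxE.
by case: (z k 0).
Qed.

Lemma hnorm_cvec v : hnorm (cvec v) = \sum_i v 0 i ^+ 2.
Proof.
rewrite big_split_ord /= -big_split /=.
by apply: eq_bigr => k _; rewrite mxE.
Qed.

Lemma cvec_continuous k : continuous (fun v => cvec v k 0 : CT).
Proof.
rewrite (_ : (fun _ => _) = fun v : 'rV[R]_(8 + 8) => ((toC (v 0 (lshift 8 k)) : CT) +
    ('i%C : CT) * (toC (v 0 (rshift 8 k)) : CT))); last first.
  by apply/funext => v; rewrite mxE; exact: complexE.
have coord i : continuous (fun v : 'rV[R]_(8 + 8) => toC (v 0 i) : CT).
  move=> v; apply: (continuous_comp (f := fun v : 'rV[R]_(8 + 8) => v 0 i)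
    (g := fun x : R => toC x : CT)); [exact: coord_continuous | exact: toC_continuous].
apply: (@continuous_fctD _ CT); first exact: coord.
by apply: (@continuous_fctM _ CT); [exact: cst_continuous | exact: coord].
Qed.

Lemma octl_cvec_continuous i j : continuous (fun v => octl (cvec v) i j : CT).
Proof.
have pos k : continuous (fun v => cvec v k 0 : CT) by exact: cvec_continuous.
have neg k : continuous (fun v => - cvec v k 0 : CT).
  by apply: (@continuous_fctN _ CT); exact: cvec_continuous.
rewrite (_ : (fun _ => _) = fun v : 'rV[R]_(8 + 8) => octl_entry (cvec v) i j); last first.
  by apply/funext => v; rewrite [LHS]mxE.
by elim/ord8P: i; elim/ord8P: j; rewrite !inord8E /octl_entry /=;
  first [exact: pos | exact: neg].
Qed.

Definition sphere_ball (c : R) : set 'rV[R]_(8 + 8) :=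
  [set v | sqnorm (cvec v) = 1 /\ hnorm (cvec v) <= c].

Lemma sphere_ball_compact c : compact (sphere_ball c).
Proof.
pose b := c + 1.
apply: (@subclosed_compact _ _ [set v : 'rV[R]_(8 + 8) | forall i, v ord0 i \in `[- b, b]]).
- apply: closedI.
    apply: (@preimage_closed _ CT (fun v => sqnorm (cvec v)) [set 1]).
      move=> v _; apply: (@continuous_fct_sum _ CT _
        (fun k v => cvec v k 0 * cvec v k 0)) => k.
      by apply: (@continuous_fctM _ CT); exact: cvec_continuous.
    exact/accessible_closed_set1/hausdorff_accessible/norm_hausdorff.
  apply: (@preimage_closed _ R (fun v => hnorm (cvec v)) [set x | x <= c]).
    by move=> v _; apply: continuous_hnorm => k; exact: cvec_continuous.
  exact: closed_le.
- apply: (@rV_compact _  _ (fun=> `[- b, b]%classic)) => i; exact: segment_compact.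
- move=> v [_ vc] i; rewrite in_itv /= -ler_norml.
  have : v 0 i ^+ 2 <= c.
    move: vc; rewrite hnorm_cvec (bigD1 i)//=; apply: le_trans; rewrite lerDl.
    by apply: sumr_ge0 => j _; exact: sqr_ge0.
  have := sqr_ge0 (`|v 0 i| - 1); rewrite sqrrB1 real_normK ?num_real//.
  by have := sqr_ge0 (v 0 i); rewrite /b; lra.
Qed.

Section Gamma.
Variable m : nat.

Definition Gamma : {pred G} := fun g => `[< arith_spin m (val g) >].

Fact Gamma1 : 1%g \in Gamma.
Proof. by apply/asboolP; exact: arith_spin1. Qed.

Fact GammaM : mulg_closed Gamma.
Proof. by move=> g h /asboolP ? /asboolP ?; apply/asboolP; exact: arith_spinM. Qed.

Fact GammaV : invg_closed Gamma.
Proof. by move=> g /asboolP ?; apply/asboolP/arith_spinV => //; exact: SO_trmxl. Qed.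

HB.instance Definition _ := isMulClosed.Build _ Gamma GammaM.
HB.instance Definition _ := isMul1Closed.Build _ Gamma Gamma1.
HB.instance Definition _ := isInvClosed.Build _ Gamma GammaV.

Definition Gamma_group : groupClosed G := Gamma.

Lemma Gamma_finite (c : R) : finite_set [set g : G | g \in Gamma /\
  exists z, [/\ sqnorm z = 1, hnorm z <= c & hnorm (val g *m z) <= c]].
Proof.
have := arith_spin_finite m c; set S := [set g | _] => fS.
apply: (@sub_finite_set _ _ (val @^-1` S)).
  by move=> g /= [/asboolP gG gz]; split=> //; exact: SO_special_orth.
by apply: finite_preimage => // x y _ _; exact: val_inj.
Qed.

(** Elements near $g$ move the base point by a bounded amount, so that only finitely many
    of them lie in the group. *)
Lemma Gamma_discrete : discrete_subgroup Gamma_group.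
Proof.
move=> g gG; pose c := 1 + orbit_norm g.
have og : hnorm base <= c.
  by rewrite hnorm_base lerDl (le_trans ler01)// hnorm_ge1// sqnorm_SO sqnorm_base.
pose S := [set x : G | x \in Gamma /\
  exists z, [/\ sqnorm z = 1, hnorm z <= c & hnorm (val x *m z) <= c]].
have fT : finite_set ((fun x : G => val x) @` (S `\ g)).
  by apply/finite_image/finite_setD; exact: Gamma_finite.
have clT : closed ((fun x : G => val x : 'M[CT]_8) @` (S `\ g)).
  have acc : accessible_space 'M[CT]_8 by exact/hausdorff_accessible/norm_hausdorff.
  by have [acl _] := accessible_finite_set_closed (T := 'M[CT]_8); exact: acl.
have gT : ~ ((fun x : G => val x : 'M[CT]_8) @` (S `\ g)) (val g).
  by move=> [x [_ xg] /val_inj].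
have nT : \forall x \near g, ~ ((fun x : G => val x : 'M[CT]_8) @` (S `\ g)) (val x).
  have nb : nbhs (val g : 'M[CT]_8)
      (~` ((fun x : G => val x : 'M[CT]_8) @` (S `\ g))).
    by apply: open_nbhs_nbhs; split=> //; rewrite openC.
  exact: (@val_SO_continuous CT 8 g _ nb).
have nc : \forall x \near g, orbit_norm x < c.
  by apply: cvgr_lt (@orbit_norm_continuous g) _ _; rewrite ltrDr.
apply: filterS2 nT nc => x xT xc xG; apply: contra_notP xT => xg.
exists x => //; split=> //; split=> //; exists base.
by rewrite sqnorm_base; split=> //; exact: ltW.
Qed.

Definition space_norm (p : homogeneous_space stab) : R := orbit_norm (repr p).

Lemma space_norm_pi (x : G) : space_norm (\pi_(homogeneous_space stab) x) = orbit_norm x.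
Proof.
rewrite /space_norm /orbit_norm; congr (hnorm _).
by apply/pi_eqP; rewrite reprK.
Qed.

Lemma space_norm_continuous : continuous space_norm.
Proof.
apply/quotient_continuous; rewrite (_ : _ \o _ = orbit_norm).
  exact: orbit_norm_continuous.
by apply/funext => x; exact: space_norm_pi.
Qed.

Lemma translate_base (g : G) (p : homogeneous_space stab) :
  val (repr (translate g p)) *m base = val g *m (val (repr p) *m base).
Proof.
rewrite mulmxA -[val g *m _]/(val (g * repr p)%g).
by apply/pi_eqP; rewrite reprK.
Qed.

(** The continuous function $|x e_0|^2$ on the homogeneous space is bounded on compact
    sets. *)
Lemma Gamma_properly_discontinuous : acts_properly_discontinuously stab Gamma_group.
Proof.
move=> K Kc.
have : compact (space_norm @` K).
  apply: continuous_compact => //; apply: continuous_subspaceT.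
  exact: space_norm_continuous.
move=> /compact_bounded[M [_ MP]].
have Kle p : K p -> space_norm p <= M + 1.
  move=> Kp; apply: le_trans (ler_norm _) _.
  by apply: (MP (M + 1)); [rewrite ltrDl | exists p].
apply: sub_finite_set (Gamma_finite (M + 1)) => g [gG [q [[p Kp pq] Kq]]].
split=> //; exists (val (repr p) *m base); split.
- by rewrite sqnorm_SO sqnorm_base.
- exact: Kle.
- by rewrite -translate_base pq; exact: Kle.
Qed.

(** Left octonion multiplication $z \mapsto L_z$ is a continuous section of the orbit map
    $g \mapsto g e_0$, as $L_z e_0 = z$.  Hence a bounded part of the sphere that meets
    every orbit maps onto the quotient. *)
Lemma Gamma_cocompact : (0 < m)%N ->
  compact [set: Clifford_Klein_form stab Gamma_group].
Proof.
move=> m0; have [c cP] := arith_spin_cocompact R m0.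
(* the section, completed by the value 1 outside the sphere *)
pose sec (v : 'rV[R]_(8 + 8)) : G := insubd (1%g : G) (octl (cvec v)).
have secE v : sqnorm (cvec v) = 1 -> val (sec v) = octl (cvec v).
  move=> v1; apply: insubdK; rewrite inE det_octl ?pnatr_eq0// v1 expr1n eqxx andbT.
  by apply/eqP/mulmx1C; rewrite octl_mulmx_tr v1.
pose f v := \pi_(Clifford_Klein_form stab Gamma_group) (\pi_(homogeneous_space stab) (sec v)).
have -> : [set: Clifford_Klein_form stab Gamma_group] = f @` sphere_ball c.
  apply/seteqP; split=> // q _; rewrite -[q]reprK -[repr q]reprK.
  set x := repr (repr q); have x1 : sqnorm (val x *m base) = 1.
    by rewrite sqnorm_SO sqnorm_base.
  have [g [gso gG gc]] := cP _ x1.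
  have gin : g \in @special_orthogonal C 8.
    by rewrite inE; case: gso => -> ->; rewrite !eqxx.
  pose h : G := Sub g gin; have hG : h \in Gamma by apply/asboolP.
  have [v vE] := cvec_surj (g *m (val x *m base)).
  have v1 : sqnorm (cvec v) = 1 by rewrite vE -[g]/(val h) sqnorm_SO.
  exists v; first by split=> //; rewrite vE.
  rewrite /f; have -> : \pi_(homogeneous_space stab) (sec v) =
      \pi_(homogeneous_space stab) (h * x)%g.
    apply/pi_eqP; rewrite secE// /base -colE col0_octl vE.
    by rewrite -[val (h * x)%g]/(g *m val x) mulmxA.
  rewrite -translate_pi.
  apply/(@eqquotP _ (orbit_equiv stab Gamma_group) {eq_quot (orbit_equiv stab Gamma_group)}).
  by rewrite /= orbit_rel_sym; apply/asboolP; exists h.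
apply: continuous_compact; last exact: sphere_ball_compact.
have csec : {within sphere_ball c, continuous sec}.
  apply: continuous_comp_initial.
  apply: (@subspace_eq_continuous _ (sphere_ball c) 'M[CT]_8 (fun v => octl (cvec v))).
    by move=> v /set_mem[v1 _]; rewrite /= secE.
  apply: continuous_subspaceT; apply: mx_continuous => i j.
  exact: octl_cvec_continuous.
move=> v; apply: continuous_comp; last exact: pi_continuous.
apply: continuous_comp; last exact: pi_continuous.
exact: csec.
Qed.

End Gamma.

Lemma Gamma_free : exists2 m : nat, (0 < m)%N & acts_freely stab (Gamma_group m).
Proof.
have [m m0 mP] := arith_spin_free R; exists m => // g p /asboolP gG gp.
apply: val_inj; apply: (mP _ (val (repr p) *m base)) => //.
- exact: SO_special_orth.
- by rewrite sqnorm_SO sqnorm_base.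
- by rewrite -translate_base gp.
Qed.

End Topology.

Theorem theorem1p1p3 (R : realType) :
  admits_compact_Clifford_Klein_form (SO R[i] 8) (SO_standard R[i] 7).
Proof.
have [m m0 free] := Gamma_free R; exists (Gamma_group R m); split=> //.
- exact: Gamma_discrete.
- exact: Gamma_properly_discontinuous.
- exact: Gamma_cocompact.
Qed.
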